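(* Let $\Gamma$ be a countable discrete group and $(X,\mu)$ a standard probability space. Then $\mathrm{A}_\sim(\Gamma,X,\mu)$, with the operations $cc_t([a],[b])=t[a]+(1-t)[b]$ ($t\in[0,1]$) and the topology induced by the metric $d$, is a topological weak convex space.
   Context: A weak convex space is a set $S$ with binary operations $cc_t$ ($t\in[0,1]$) such that for all $x,y,z\in S$ and $s,t\in[0,1]$: (1) $cc_0(x,y)=y$; (3) $cc_t(x,y)=cc_{1-t}(y,x)$; (4) $cc_t(cc_s(x,y),z)=cc_{st}\bigl(x,cc_{\frac{t(1-s)}{1-st}}(y,z)\bigr)$ (when $st=1$ the inner parameter is arbitrary). One writes $tx+(1-t)y$ for $cc_t(x,y)$. A topological weak convex space is a topological space with a weak convex structure such that $[0,1]\times S^2\to S$, $(t,x,y)\mapsto cc_t(x,y)$, is continuous. A probability space is a standard Borel space with a Borel probability measure (atoms allowed, possibly countable or finite); it is a standard probability space if the measure is nonatomic. A measure-preserving action $\Gamma\curvearrowright^a(Y,\nu)$ is a Borel action preserving $\nu$, two actions being identified if they agree almost everywhere; $\gamma^a$ denotes the transformation given by $\gamma\in\Gamma$. $\mathrm{A}(\Gamma,X,\mu)$ is the set of measure-preserving actions of $\Gamma$ on $(X,\mu)$. Weak containment: for actions $a$ on $(X,\mu)$ and $b$ on $(Y,\nu)$, $a\prec b$ if for all measurable $A_1,\dots,A_n\subseteq X$, finite $F\subseteq\Gamma$ and $\epsilon>0$ there are measurable $B_1,\dots,B_n\subseteq Y$ with $|\mu(\gamma^aA_i\cap A_j)-\nu(\gamma^bB_i\cap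 B_j)|<\epsilon$ for all $\gamma\in F$, $i,j\le n$. $a\sim b$ means $a\prec b$ and $b\prec a$, and $\mathrm{A}_\sim(\Gamma,X,\mu)=\mathrm{A}(\Gamma,X,\mu)/\!\sim$. Topology: fix an enumeration $(\gamma_i)_{i\ge1}$ of $\Gamma$ (with repetitions if $\Gamma$ is finite). For $a\in \mathrm{A}(\Gamma,X,\mu)$ and a measurable partition $\mathcal A=\{A_1,\dots,A_k\}$ of $X$ into $k$ pieces let $M^{\mathcal A}_{n,k}(a)\in[0,1]^{n\times k\times k}$ have $(p,q,r)$ coordinate $\mu(\gamma_p^aA_q\cap A_r)$, let $C_{n,k}(a)$ be the closure of the set of all $M^{\mathcal A}_{n,k}(a)$ over such $\mathcal A$, and let $d(a,b)=\sum_{n,k=1}^\infty 2^{-(n+k)}d_H(C_{n,k}(a),C_{n,k}(b))$, where $d_H$ is the Hausdorff distance (from the supremum metric on $[0,1]^{n\times k\times k}$). Then $d(a,b)=0$ iff $a\sim b$, so $d$ induces a metric on $\mathrm{A}_\sim(\Gamma,X,\mu)$. Convex structure: for $a,b\in\mathrm{A}(\Gamma,X,\mu)$ and $t\in[0,1]$, $t[a]+(1-t)[b]$ is the weak equivalence class of the action on $X_1\sqcup X_2$ (two copies of $X$, with measure $t\mu$ on $X_1$ and $(1-t)\mu$ on $X_2$) acting as $a$ on $X_1$ and $b$ on $X_2$, transported to $(X,\mu)$ by any isomorphism of probability spaces; the class does not depend on the isomorphism or on the representatives. *)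

(* Defs.v *)
From HB Require Import structures.
From mathcomp Require Import all_boot all_order all_algebra generic_quotient.
From mathcomp Require Import all_classical all_reals all_analysis ring lra.

Set Implicit Arguments.
Unset Strict Implicit.
Unset Printing Implicit Defensive.

Import Order.TTheory GRing.Theory Num.Theory.
Import numFieldNormedType.Exports.

Local Open Scope quotient_scope.
Local Open Scope classical_set_scope.
Local Open Scope ring_scope.

(* When s * t = 1 the inner parameter r of associativity is arbitrary. *)
Record weak_convex (R : realFieldType) (S : Type)
    (cc : {i01 R} -> S -> S -> S) : Prop := WeakConvex {
  weak_convex0 : forall x y, cc 0%:i01 x y = y;
  weak_convexC : forall t x y, cc t x y = cc (1 - t%:num)%:i01 y x;
  weak_convexA : forall (s t r : {i01 R}) x y z,
    (s%:num * t%:num != 1 ->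
      r%:num = t%:num * (1 - s%:num) / (1 - s%:num * t%:num)) ->
    cc t (cc s x y) z = cc (s%:num * t%:num)%:i01 x (cc r y z) }.

Definition topological_weak_convex (R : realType) (S : topologicalType)
    (cc : {i01 R} -> S -> S -> S) : Prop :=
  weak_convex cc /\
  continuous (fun z : initial_topology (fun t : {i01 R} => t%:num) * (S * S) =>
    cc z.1 z.2.1 z.2.2).

(* Isomorphic, as a measurable space, to the Borel space of a Polish space. *)
Definition standard_borel (R : realType) d (X : measurableType d) : Prop :=
  exists (T : completePseudoMetricType R) (f : X -> T),
    [/\ hausdorff_space T,
        exists2 D : set T, countable D & dense D,
        bijective f &
        forall A : set T, measurable (f @^-1` A) <-> <<s open >> A].

Definition nonatomic (R : realType) d (X : measurableType d)
    (mu : {measure set X -> \bar R}) : Prop :=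
  forall A, measurable A -> (0 < mu A)%E ->
    exists B, [/\ measurable B, B `<=` A & (0 < mu B < mu A)%E].

Record mp_action (G : groupType) (R : realType) d (X : measurableType d)
    (mu : probability X R) := MPAction {
  mp_act :> G -> X -> X;
  mp_act1 : forall x, mp_act 1%g x = x;
  mp_actM : forall g h x, mp_act (g * h)%g x = mp_act g (mp_act h x);
  measurable_mp_act : forall g, measurable_fun [set: X] (mp_act g);
  mp_act_preserving :
    forall g A, measurable A -> mu (mp_act g @^-1` A) = mu A }.

HB.instance Definition _ (G : groupType) (R : realType) d
  (X : measurableType d) (mu : probability X R) :=
  gen_eqMixin (mp_action G mu).
HB.instance Definition _ (G : groupType) (R : realType) d
  (X : measurableType d) (mu : probability X R) :=
  gen_choiceMixin (mp_action G mu).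

Section weak_containment.
Context (G : groupType) (R : realType).

Definition weakly_contained d (X : measurableType d) (mu : probability X R)
    d' (Y : measurableType d') (nu : probability Y R)
    (a : mp_action G mu) (b : mp_action G nu) : Prop :=
  forall (n : nat) (A : 'I_n -> set X) (F : set G) (eps : R),
    (forall i, measurable (A i)) -> finite_set F -> 0 < eps ->
    exists B : 'I_n -> set Y, (forall i, measurable (B i)) /\
      forall g, F g -> forall i j,
        `|fine (mu (a g @` A i `&` A j)) - fine (nu (b g @` B i `&` B j))|
          < eps.

Lemma weakly_contained_refl d (X : measurableType d) (mu : probability X R)
  (a : mp_action G mu) : weakly_contained a a.
Proof.
by move=> n A F eps mA _ eps0; exists A; split=> // g _ i j; rewrite subrr normr0.
Qed.

Lemma weakly_contained_trans d1 (X : measurableType d1) (mu : probability X R)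
    d2 (Y : measurableType d2) (nu : probability Y R)
    d3 (Z : measurableType d3) (rho : probability Z R)
    (a : mp_action G mu) (b : mp_action G nu) (c : mp_action G rho) :
  weakly_contained a b -> weakly_contained b c -> weakly_contained a c.
Proof.
move=> ab bc n A F eps mA finF eps0; have eps2 : 0 < eps / 2 by rewrite divr_gt0.
have [B [mB AB]] := ab n A F _ mA finF eps2.
have [C [mC BC]] := bc n B F _ mB finF eps2.
exists C; split=> // g Fg i j.
rewrite (splitr eps) (le_lt_trans (ler_distD (fine (nu (b g @` B i `&` B j))) _ _))//.
by rewrite ltrD ?AB ?BC.
Qed.

Context d (X : measurableType d) (mu : probability X R).

Definition weakly_equivalent : rel (mp_action G mu) :=
  fun a b => `[< weakly_contained a b /\ weakly_contained b a >].

Lemma weakly_equivalent_refl : reflexive weakly_equivalent.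
Proof. by move=> a; apply/asboolP; split; exact: weakly_contained_refl. Qed.

Lemma weakly_equivalent_sym : symmetric weakly_equivalent.
Proof. by move=> a b; apply/asboolP/asboolP => -[]. Qed.

Lemma weakly_equivalent_trans : transitive weakly_equivalent.
Proof.
move=> b a c /asboolP[ab ba] /asboolP[bc cb]; apply/asboolP.
by split; [exact: weakly_contained_trans bc|exact: weakly_contained_trans ba].
Qed.

Canonical weakly_equivalent_equiv :=
  EquivRel weakly_equivalent weakly_equivalent_refl weakly_equivalent_sym
    weakly_equivalent_trans.

End weak_containment.

Section hausdorff_distance.
Context (R : realType) (V : normedModType R).
Implicit Types (A B C : set V) (x y : V) (r M : R).

Definition point_dist x A : R := inf [set `|x - y| | y in A].

Definition hausdorff_dist A B : R :=
  Num.max (sup [set point_dist x B | x in A])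
          (sup [set point_dist y A | y in B]).

Lemma hausdorff_distC A B : hausdorff_dist A B = hausdorff_dist B A.
Proof. by rewrite /hausdorff_dist maxC. Qed.

Lemma point_dist_le x y A : A y -> point_dist x A <= `|x - y|.
Proof.
move=> Ay; apply: ge_inf; last by exists y.
by exists 0 => _ [z _ <-]; exact: normr_ge0.
Qed.

Lemma point_dist_ge0 x A : 0 <= point_dist x A.
Proof.
have [->|/set0P[y Ay]] := eqVneq A set0.
  by rewrite /point_dist image_set0 inf0.
apply: lb_le_inf; first by exists `|x - y|, y.
by move=> _ [z _ <-]; exact: normr_ge0.
Qed.

Definition excess A B : R := sup [set point_dist x B | x in A].

Lemma excess_le A B r : 0 <= r ->
  (forall x, A x -> point_dist x B <= r) -> excess A B <= r.
Proof.
move=> r0 Ar; have [->|/set0P[y Ay]] := eqVneq A set0.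
  by rewrite /excess image_set0 sup0.
apply: ge_sup; first by exists (point_dist y B), y.
by move=> _ [z Az <-]; exact: Ar.
Qed.

Lemma hausdorff_dist_le A B r : 0 <= r ->
  (forall x, A x -> point_dist x B <= r) ->
  (forall x, B x -> point_dist x A <= r) -> hausdorff_dist A B <= r.
Proof. by move=> *; rewrite ge_max; apply/andP; split; exact: excess_le. Qed.

Section bounded.
Context (M : R).
Local Notation bnd A := (A !=set0 /\ forall x, A x -> `|x| <= M).

Let point_dist_bnd x B : `|x| <= M -> bnd B -> point_dist x B <= M + M.
Proof.
move=> xM [[y By] BM]; apply: le_trans (point_dist_le x By) _.
by rewrite (le_trans (ler_normB _ _))// lerD// BM.
Qed.

Let excess_ge A B x : bnd A -> bnd B -> A x -> point_dist x B <= excess A B.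
Proof.
move=> [A0 AM] bB Ax; apply: ub_le_sup; last by exists x.
by exists (M + M) => _ [z Az <-]; apply: point_dist_bnd => //; exact: AM.
Qed.

Lemma hausdorff_dist_bnd A B : bnd A -> bnd B -> hausdorff_dist A B <= M + M.
Proof.
move=> bA bB; have M0 : 0 <= M.
  by case: bA => -[x Ax] /(_ _ Ax); exact: le_trans.
apply: hausdorff_dist_le => [|x Ax|x Bx]; first exact: addr_ge0.
- by apply: point_dist_bnd => //; exact: bA.2.
- by apply: point_dist_bnd => //; exact: bB.2.
Qed.

Lemma hausdorff_dist_ge A B x : bnd A -> bnd B -> A x ->
  point_dist x B <= hausdorff_dist A B.
Proof. by move=> bA bB Ax; rewrite le_max (excess_ge bA bB Ax). Qed.

Lemma hausdorff_dist_ge0 A B : bnd A -> bnd B -> 0 <= hausdorff_dist A B.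
Proof.
move=> bA bB; have [x Ax] := bA.1.
exact: le_trans (point_dist_ge0 x B) (hausdorff_dist_ge bA bB Ax).
Qed.

Lemma hausdorff_distxx A : hausdorff_dist A A <= 0.
Proof.
by apply: hausdorff_dist_le => // x Ax;
  rewrite (le_trans (point_dist_le x Ax))// subrr normr0.
Qed.

Lemma hausdorff_dist_near A B x r : bnd A -> bnd B -> A x ->
  hausdorff_dist A B < r -> exists2 y, B y & `|x - y| < r.
Proof.
move=> bA bB Ax /(le_lt_trans (hausdorff_dist_ge bA bB Ax)).
have [y0 By0] := bB.1.
move=> /inf_lt[|_ [y By <-]]; first by exists `|x - y0|, y0.
by exists y.
Qed.

Lemma hausdorff_dist_triangle B A C : bnd A -> bnd B -> bnd C ->
  hausdorff_dist A C <= hausdorff_dist A B + hausdorff_dist B C.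
Proof.
move=> bA bB bC; have half A' B' C' x : bnd A' -> bnd B' -> bnd C' -> A' x ->
    point_dist x C' <= hausdorff_dist A' B' + hausdorff_dist B' C'.
  move=> bA' bB' bC' Ax; apply/ler_addgt0Pr => e e0.
  have e20 : 0 < e / 2 by rewrite divr_gt0.
  have [y By xy] : exists2 y, B' y & `|x - y| < hausdorff_dist A' B' + e / 2.
    by apply: (hausdorff_dist_near bA' bB' Ax); rewrite ltrDl.
  have [z Cz yz] : exists2 z, C' z & `|y - z| < hausdorff_dist B' C' + e / 2.
    by apply: (hausdorff_dist_near bB' bC' By); rewrite ltrDl.
  rewrite (le_trans (point_dist_le x Cz))// (le_trans (ler_distD y _ _))//.
  by rewrite (splitr e) addrACA lerD// ltW.
apply: hausdorff_dist_le => [|x|x Cx]; first by rewrite addr_ge0 ?hausdorff_dist_ge0.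
- exact: half.
- by rewrite addrC (hausdorff_distC B) (hausdorff_distC A); exact: half.
Qed.

End bounded.
End hausdorff_distance.

Section double_series.
Context (R : realType).
Implicit Types (f g : nat -> nat -> R) (c : R).

Definition double_series f : R :=
  limn (series (fun n => limn (series (f n)))).

Let dominated c f := forall n k, 0 <= f n k <= c * (2^-1 ^+ n * 2^-1 ^+ k).

Let cvg_geom c : cvgn (series (geometric c (2^-1 : R))).
Proof.
by apply: is_cvg_geometric_series; rewrite ger0_norm ?invr_ge0// invf_lt1 ?ltr1n.
Qed.

Let geomE c n : (fun k => c * (2^-1 ^+ n * 2^-1 ^+ k)) =
  geometric (c * 2^-1 ^+ n) (2^-1 : R).
Proof. by apply/funext => k /=; rewrite mulrA. Qed.

Let inner_cvg c f n : dominated c f -> cvgn (series (f n)).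
Proof.
move=> fc; apply: (@series_le_cvg _ _ (geometric (c * 2^-1 ^+ n) 2^-1)).
- by move=> k; have /andP[] := fc n k.
- by move=> k; rewrite -geomE; have /andP[h1 h2] := fc n k; exact: le_trans h2.
- by move=> k; rewrite -geomE; have /andP[] := fc n k.
- exact: cvg_geom.
Qed.

Let nd_series (u : R^nat) : (forall n, 0 <= u n) -> nondecreasing_seq (series u).
Proof. by move=> u0; apply: nondecreasing_series => k _ _; exact: u0. Qed.

Let term_le_lim (u : R^nat) n : (forall n, 0 <= u n) -> cvgn (series u) ->
  u n <= limn (series u).
Proof.
move=> u0 cu; apply: le_trans (nondecreasing_cvgn_le (nd_series u0) cu n.+1).
by rewrite /series/= big_nat_recr//= lerDr sumr_ge0.
Qed.

Let inner_ge0 c f n : dominated c f -> 0 <= limn (series (f n)).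
Proof.
move=> fc; have f0 k : 0 <= f n k by have /andP[] := fc n k.
exact: le_trans (f0 0%N) (@term_le_lim (f n) 0%N f0 (inner_cvg fc)).
Qed.

Let inner_le c f n : dominated c f ->
  limn (series (f n)) <= (c * 2) * 2^-1 ^+ n.
Proof.
move=> fc; have -> : (c * 2) * 2^-1 ^+ n = limn (series (geometric (c * 2^-1 ^+ n) (2^-1 : R))).
  apply/esym/cvg_lim => //; rewrite mulrAC.
  have := @cvg_geometric_series R (c * 2^-1 ^+ n) 2^-1.
  rewrite (_ : (1 - 2^-1)^-1 = 2); last by field.
  by apply; rewrite ger0_norm ?invr_ge0// invf_lt1 ?ltr1n.
apply: lim_series_le; [exact: inner_cvg fc|exact: cvg_geom|].
by move=> k; rewrite -geomE; have /andP[] := fc n k.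
Qed.

Let outer_cvg c f : dominated c f ->
  cvgn (series (fun n => limn (series (f n)))).
Proof.
move=> fc; apply: (@series_le_cvg _ _ (geometric (c * 2) 2^-1)).
- by move=> n; exact: inner_ge0 fc.
- by move=> n /=; exact: le_trans (inner_ge0 n fc) (inner_le n fc).
- by move=> n; exact: inner_le fc.
- exact: cvg_geom.
Qed.

Lemma double_series_ge c f n k :
  (forall n k, 0 <= f n k <= c * (2^-1 ^+ n * 2^-1 ^+ k)) ->
  f n k <= double_series f.
Proof.
move=> fc; apply: (@le_trans _ _ (limn (series (f n)))).
  apply: (@term_le_lim (f n)) (inner_cvg fc) => j.
  by have /andP[] := fc n j.
apply: (@term_le_lim (fun n => limn (series (f n)))) (outer_cvg fc) => j.
exact: inner_ge0 fc.
Qed.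

Lemma double_series_leD c f g h :
  (forall n k, 0 <= f n k <= c * (2^-1 ^+ n * 2^-1 ^+ k)) ->
  (forall n k, 0 <= g n k <= c * (2^-1 ^+ n * 2^-1 ^+ k)) ->
  (forall n k, 0 <= h n k <= c * (2^-1 ^+ n * 2^-1 ^+ k)) ->
  (forall n k, f n k <= g n k + h n k) ->
  double_series f <= double_series g + double_series h.
Proof.
move=> fc gc hc fgh.
rewrite /double_series -lim_seriesD; [|exact: outer_cvg gc|exact: outer_cvg hc].
apply: lim_series_le; first exact: outer_cvg fc.
  by apply: is_cvg_seriesD; [exact: outer_cvg gc|exact: outer_cvg hc].
move=> n; rewrite [leRHS]/GRing.add/= -lim_seriesD;
  [|exact: inner_cvg gc|exact: inner_cvg hc].
apply: lim_series_le; first exact: inner_cvg fc.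
  by apply: is_cvg_seriesD; [exact: inner_cvg gc|exact: inner_cvg hc].
by move=> k; exact: fgh.
Qed.

Lemma double_series0 : double_series (fun _ _ => 0 : R) = 0.
Proof.
have s0 : series (fun=> 0 : R) = fun=> 0.
  by apply/funext => n; rewrite /series/= big1.
by rewrite /double_series s0 lim_cst// s0 lim_cst.
Qed.

End double_series.

Section action_theory.
Context (G : groupType) (R : realType) d (X : measurableType d)
  (mu : probability X R) (a : mp_action G mu).

Lemma mp_actK g : cancel (a g) (a g^-1%g).
Proof. by move=> x; rewrite -mp_actM mulVg mp_act1. Qed.

Lemma mp_actVK g : cancel (a g^-1%g) (a g).
Proof. by move=> x; rewrite -mp_actM mulgV mp_act1. Qed.

Lemma mp_act_image g (A : set X) : a g @` A = a g^-1%g @^-1` A.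
Proof.
apply/seteqP; split => [_ [x Ax <-]|y Ay] /=; first by rewrite mp_actK.
by exists (a g^-1%g y) => //; rewrite mp_actVK.
Qed.

Lemma measurable_mp_act_image g (A : set X) :
  measurable A -> measurable (a g @` A).
Proof.
move=> mA; rewrite mp_act_image -[X in measurable X]setTI.
exact: measurable_mp_act.
Qed.

End action_theory.

(* Pieces may be empty. *)
Definition measurable_partition d (X : measurableType d) k
    (A : 'I_k -> set X) : Prop :=
  [/\ forall i, measurable (A i), trivIset setT A & \bigcup_i A i = setT].

Section fine_measure.
Context (R : realType) d (X : measurableType d) (mu : probability X R).

Lemma fine_measure_bigcup k (F : 'I_k -> set X) (K : {set 'I_k}) :
  (forall i, measurable (F i)) -> trivIset setT F ->
  fine (mu (\bigcup_(q in [set` K]) F q)) = \sum_(q in K) fine (mu (F q)).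
Proof.
move=> mF tF; pose F' q := if q \in K then F q else set0.
have mF' q : measurable (F' q) by rewrite /F'; case: ifP.
have -> : \bigcup_(q in [set` K]) F q = \big[setU/set0]_(q < k) F' q.
  rewrite -bigcup_seq; apply/seteqP; split => x.
    move=> [q /= qK Fq]; exists q; first by rewrite /= mem_index_enum.
    by rewrite /F' qK.
  by move=> [q _]; rewrite /F'; case: ifPn => // qK Fq; exists q.
rewrite measure_semi_additive_ord//.
- rewrite -sum_fine//; last by move=> q _; exact: fin_num_measure.
  rewrite [RHS]big_mkcond/=; apply: eq_bigr => q _.
  by rewrite /F'; case: ifP => // _; rewrite measure0.
- move=> i j _ _; rewrite /F'; case: ifPn => _; last by case=> x [].
  by case: ifPn => _; [exact: tF|case=> x []].
- by apply: bigsetU_measurable => q _; exact: mF'.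
Qed.

Lemma le_fine_measure (A B : set X) : measurable A -> measurable B ->
  A `<=` B -> fine (mu A) <= fine (mu B).
Proof.
move=> mA mB AB; apply: fine_le; try exact: fin_num_measure.
by apply: le_measure => //; rewrite inE.
Qed.

Lemma fine_measureU_le (A B : set X) : measurable A -> measurable B ->
  fine (mu (A `|` B)) <= fine (mu A) + fine (mu B).
Proof.
move=> mA mB; rewrite -fineD; try exact: fin_num_measure.
apply: fine_le; rewrite ?fin_numD ?fin_num_measure//; first exact: measurableU.
exact: measureU2.
Qed.

Lemma fine_measure_bigcup_le k (F : 'I_k -> set X) (K : {set 'I_k}) r :
  (forall i, measurable (F i)) -> (forall i, i \in K -> fine (mu (F i)) <= r) ->
  0 <= r -> fine (mu (\bigcup_(q in [set` K]) F q)) <= k%:R * r.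
Proof.
move=> mF Fr r0; have mFK : measurable (\bigcup_(q in [set` K]) F q).
  by apply: fin_bigcup_measurable => //; exact: finite_finset.
pose F' q := if q \in K then F q else set0.
have mF' q : measurable (F' q) by rewrite /F'; case: ifP.
have E : \bigcup_(q in [set` K]) F q = \big[setU/set0]_(q < k) F' q.
  rewrite -bigcup_seq; apply/seteqP; split => x.
    move=> [q /= qK Fq]; exists q; first by rewrite /= mem_index_enum.
    by rewrite /F' qK.
  by move=> [q _]; rewrite /F'; case: ifPn => // qK Fq; exists q.
rewrite E; apply: (@le_trans _ _ (\sum_(q < k) fine (mu (F' q)))).
  suff : measurable (\big[setU/set0]_(q < k) F' q) /\
      fine (mu (\big[setU/set0]_(q < k) F' q)) <= \sum_(q < k) fine (mu (F' q)).
    by case.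
  elim/big_ind2 : _ => [|A u B v [mA Au] [mB Bv]|q _]; rewrite ?measure0//.
  split; first exact: measurableU.
  by apply: le_trans (fine_measureU_le mA mB) _; rewrite lerD.
rewrite mulr_natl -[X in _ <= _ *+ X]card_ord -sumr_const.
apply: ler_sum => q _; rewrite /F'; case: ifPn => [/Fr//|_].
by rewrite measure0.
Qed.

Lemma fine_measure_setD_le (A B : set X) : measurable A -> measurable B ->
  fine (mu A) <= fine (mu B) + fine (mu (A `\` B)).
Proof.
move=> mA mB; apply: le_trans (fine_measureU_le mB (measurableD mA mB)).
apply: le_fine_measure => //; first by apply: measurableU => //; exact: measurableD.
by move=> x Ax; have [Bx|nBx] := pselect (B x); [left|right].
Qed.

Lemma fine_measure_dist_le (A B : set X) (r : R) :
  measurable A -> measurable B ->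
  fine (mu (A `\` B)) <= r -> fine (mu (B `\` A)) <= r ->
  `|fine (mu A) - fine (mu B)| <= r.
Proof.
move=> mA mB ABr BAr; rewrite ler_norml; apply/andP; split.
  have := fine_measure_setD_le mB mA; lra.
have := fine_measure_setD_le mA mB; lra.
Qed.

Lemma fine_measure_partition k (A : 'I_k -> set X) : measurable_partition A ->
  \sum_(q < k) fine (mu (A q)) = 1.
Proof.
move=> [mA tA AT].
have := fine_measure_bigcup (finset.setTfor 'I_k) mA tA.
rewrite (_ : \bigcup_(q in _) A q = setT); last first.
  by rewrite -AT; apply: eq_bigcupl; split => q //= _; rewrite finset.in_setT.
rewrite probability_setT/= => ->; apply: eq_bigl => q.
by rewrite finset.in_setT.
Qed.

(* A family of sets with small pairwise intersections and almost full total
   measure is close to a partition. *)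
Lemma near_partition k (B : 'I_k.+1 -> set X) (r : R) :
  (forall i, measurable (B i)) ->
  (forall i j, i != j -> fine (mu (B i `&` B j)) <= r) -> 0 <= r ->
  1 - r <= \sum_(i < k.+1) fine (mu (B i)) ->
  exists C : 'I_k.+1 -> set X, [/\ measurable_partition C,
    forall i, fine (mu (B i `\` C i)) <= k.+1%:R * r &
    forall i, fine (mu (C i `\` B i)) <= (1 + k.+1%:R * k.+1%:R) * r].
Proof.
move=> mB Br r0 Bsum.
pose L (i : 'I_k.+1) : {set 'I_k.+1} := [set j : 'I_k.+1 | (j < i)%N]%SET.
pose D i := B i `\` \bigcup_(j in [set` L i]) B j.
pose E := ~` \bigcup_i B i.
pose C i := if i == ord0 then D i `|` E else D i.
have mU (K : {set 'I_k.+1}) : measurable (\bigcup_(j in [set` K]) B j).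
  by apply: fin_bigcup_measurable => //; exact: finite_finset.
have mD i : measurable (D i) by exact: measurableD.
have mE : measurable E.
  by apply: measurableC; exact: fin_bigcup_measurable.
have mC i : measurable (C i).
  by rewrite /C; case: ifP => // _; exact: measurableU.
have DB i : D i `<=` B i by move=> x [].
have DC i : D i `<=` C i.
  by rewrite /C; case: ifP => _ x Dx; [left|].
have nDE i x : D i x -> ~ E x by move=> /DB Bx; apply; exists i.
have tD i j x : D i x -> D j x -> i = j.
  move=> Di Dj; apply/val_inj; case: (ltngtP i j) => // ij.
    by case: Dj => _ []; exists i; [rewrite /= inE|exact: DB Di].
  by case: Di => _ []; exists j; [rewrite /= inE|exact: DB Dj].
have CD x i : C i x -> D i x \/ (i = ord0 /\ E x).
  by rewrite /C; case: eqP => [-> []|_]; [left|right|left].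
have covD : ~` E `<=` \bigcup_i D i.
  move=> x /contrapT [i _ Bx].
  have [j /set_mem Bj jmin] := @arg_minnP _ i (fun i => x \in B i) val (mem_set Bx).
  exists j => //; split => // -[l /=]; rewrite inE => lj /mem_set/jmin.
  by rewrite leqNgt lj.
have pC : measurable_partition C.
  split=> //.
    move=> i j _ _ [x [/CD[Di|[-> Ex]] /CD[Dj|[-> Ex']]]] //.
    - exact: tD Di Dj.
    - by have := nDE _ _ Di.
    - by have := nDE _ _ Dj.
  apply/seteqP; split => // x _; have [Ex|nEx] := pselect (E x).
    by exists ord0 => //; rewrite /C eqxx; right.
  by have [i _ Di] := covD x nEx; exists i => //; exact: DC.
have BD i : fine (mu (B i `\` D i)) <= k.+1%:R * r.
  have -> : B i `\` D i = \bigcup_(j in [set` L i]) (B i `&` B j).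
    rewrite -setI_bigcupr /D setDD; apply/seteqP; split => x [Bx Ux]; split => //.
  apply: fine_measure_bigcup_le => //; first by move=> j; exact: measurableI.
  move=> j; rewrite inE => ji; apply: Br.
  by apply: contraTneq ji => ->; rewrite ltnn.
have Emu : fine (mu E) <= (1 + k.+1%:R * k.+1%:R) * r.
  have := fine_measure_partition pC.
  have CDE : \sum_(q < k.+1) fine (mu (C q)) =
      \sum_(q < k.+1) fine (mu (D q)) + fine (mu E).
    rewrite !big_ord_recl /C eqxx -addrA [_ + fine (mu E)]addrC addrA; congr +%R.
    rewrite measureU//; first by rewrite fineD ?fin_num_measure.
    by apply/seteqP; split => // x [/nDE].
  rewrite CDE.
  have : \sum_(q < k.+1) (fine (mu (B q)) - k.+1%:R * r) <=
      \sum_(q < k.+1) fine (mu (D q)).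
    apply: ler_sum => q _.
    have := fine_measure_setD_le (mB q) (mD q); have := BD q; lra.
  rewrite sumrB sumr_const card_ord -[_ *+ k.+1]mulr_natl mulrA; lra.
exists C; split => // i.
  apply: le_trans (BD i); apply: le_fine_measure; try exact: measurableD.
  by apply: setDS; exact: DC.
apply: le_trans Emu; apply: le_fine_measure => //; first exact: measurableD.
by move=> x [/CD[/DB//|[]]].
Qed.

End fine_measure.

Section weak_distance.
Context (G : groupType) (e : nat -> G) (R : realType).

Section one_action.
Context d (X : measurableType d) (mu : probability X R).
Implicit Type a : mp_action G mu.

(* An n x k x k array is stored as an n x (k * k) matrix, coordinate (p, q, r)
   being the entry (p, mxvec_index q r); the library norm on matrices is the
   supremum norm. *)
Definition statistics n k a (A : 'I_k -> set X) : 'M[R]_(n, k * k) :=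
  \matrix_(p < n)
    mxvec (\matrix_(q < k, r < k) fine (mu (a (e p) @` A q `&` A r))).

Definition closed_statistics n k a : set 'M[R]_(n, k * k) :=
  closure [set @statistics n k a A | A in @measurable_partition _ X k].

Lemma statisticsE n k a (A : 'I_k -> set X) p q r :
  @statistics n k a A p (mxvec_index q r) =
  fine (mu (a (e p) @` A q `&` A r)).
Proof. by rewrite mxE mxvecE mxE. Qed.

Lemma statistics_norm n k a (A : 'I_k -> set X) :
  measurable_partition A -> `|@statistics n k a A| <= 1.
Proof.
move=> [mA _ _]; rewrite {1}/Num.norm/= mx_normrE; apply: bigmax_le => // -[p j] _.
case/mxvec_indexP: j => q r; rewrite statisticsE.
have mS : measurable (a (e p) @` A q `&` A r).
  by apply: measurableI => //; exact: measurable_mp_act_image.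
rewrite ger0_norm ?fine_ge0//.
by rewrite -lee_fin fineK ?probability_le1// fin_num_measure.
Qed.

Lemma closed_statistics_bounded n k a :
  @closed_statistics n k.+1 a !=set0 /\
  forall M, @closed_statistics n k.+1 a M -> `|M| <= 1.
Proof.
split.
  exists (@statistics n k.+1 a (fun i => if i == ord0 then setT else set0)).
  apply: subset_closure; exists (fun i => if i == ord0 then setT else set0) => //.
  split.
  - by move=> i; case: ifP.
  - move=> i j _ _ [x []]; case: eqP => [->|//] _; case: eqP => [->|//] _.
    by [].
  - by apply/seteqP; split => // x _; exists ord0.
move=> M CM.
have cl : closed (closed_ball_ Num.norm (0 : 'M[R]_(n, k.+1 * k.+1)) 1).
  exact: closed_closed_ball_.
suff : closed_ball_ Num.norm (0 : 'M[R]_(n, k.+1 * k.+1)) 1 M.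
  by rewrite /closed_ball_ /= sub0r normrN.
move: CM; rewrite [X in _ -> X M](closure_id _).1//; apply: closureS.
move=> _ [A pA <-]; rewrite /closed_ball_ /= sub0r normrN.
exact: statistics_norm.
Qed.

Lemma statistics_additive k a (A : 'I_k -> set X) (I J : {set 'I_k}) g :
  measurable_partition A ->
  fine (mu (a g @` (\bigcup_(q in [set` I]) A q) `&`
            \bigcup_(r in [set` J]) A r)) =
  \sum_(q in I) \sum_(r in J) fine (mu (a g @` A q `&` A r)).
Proof.
move=> [mA tA _].
have add := @fine_measure_bigcup R d X mu k.
have mgA q : measurable (a g @` A q) by exact: measurable_mp_act_image.
rewrite image_bigcup setI_bigcupl add.
- apply: eq_bigr => q _; rewrite setI_bigcupr add//.
    by move=> r; exact: measurableI.
  by move=> r s _ _ [x [[_ xr] [_ xs]]]; apply: tA => //; exists x.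
- move=> q; apply: measurableI => //.
  by apply: fin_bigcup_measurable => //; exact: finite_finset.
- move=> q r _ _ [x [[+ _] [+ _]]]; rewrite !mp_act_image/= => xq xr.
  by apply: tA => //; eexists; split; [exact: xq|exact: xr].
Qed.

End one_action.

Section distance.
Context d (X : measurableType d) (mu : probability X R).
Implicit Types a b c : mp_action G mu.

(* The indices start at 0: the (n, k) term concerns the first n + 1 group
   elements and partitions into k + 1 pieces. *)
Definition weak_dist_term a b (n k : nat) : R :=
  2^-1 ^+ (n.+1 + k.+1) *
  hausdorff_dist (@closed_statistics _ X mu n.+1 k.+1 a)
                 (@closed_statistics _ X mu n.+1 k.+1 b).

Definition weak_dist a b : R := double_series (weak_dist_term a b).

Lemma weak_dist_term_bound a b n k :
  0 <= weak_dist_term a b n k <= 1 * (2^-1 ^+ n * 2^-1 ^+ k).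
Proof.
have bA := @closed_statistics_bounded _ X mu n.+1 k a.
have bB := @closed_statistics_bounded _ X mu n.+1 k b.
have h0 := hausdorff_dist_ge0 bA bB.
have h2 := hausdorff_dist_bnd bA bB.
have p0 : 0 <= 2^-1 ^+ n * 2^-1 ^+ k :> R by rewrite mulr_ge0// exprn_ge0// invr_ge0.
rewrite /weak_dist_term addSn addnS !exprS exprD.
set h := hausdorff_dist _ _ in h0 h2 *.
by move: p0; set p := _ * _ => p0; apply/andP; split; nra.
Qed.

Lemma weak_distC a b : weak_dist a b = weak_dist b a.
Proof.
congr double_series; apply/funext => n; apply/funext => k.
by rewrite /weak_dist_term hausdorff_distC.
Qed.

Lemma weak_distxx a : weak_dist a a = 0.
Proof.
rewrite /weak_dist (_ : weak_dist_term a a = fun _ _ => 0) ?double_series0//.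
apply/funext => n; apply/funext => k; apply/eqP; rewrite eq_le.
have /andP[-> _] := weak_dist_term_bound a a n k; rewrite andbT.
by rewrite /weak_dist_term mulr_ge0_le0 ?hausdorff_distxx// exprn_ge0// invr_ge0.
Qed.

Lemma weak_dist_triangle b a c : weak_dist a c <= weak_dist a b + weak_dist b c.
Proof.
apply: (@double_series_leD _ 1); try exact: weak_dist_term_bound.
move=> n k; rewrite /weak_dist_term -mulrDr ler_wpM2l ?exprn_ge0 ?invr_ge0//.
by apply: (@hausdorff_dist_triangle _ _ 1); exact: closed_statistics_bounded.
Qed.

Lemma weak_dist0_near a b n k (A : 'I_k.+1 -> set X) (eps : R) :
  weak_dist a b = 0 -> measurable_partition A -> 0 < eps ->
  exists2 B, measurable_partition B & forall (p : 'I_n.+1) q r,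
    `|fine (mu (a (e p) @` A q `&` A r)) -
      fine (mu (b (e p) @` B q `&` B r))| < eps.
Proof.
move=> ab0 pA eps0.
have bA := @closed_statistics_bounded _ X mu n.+1 k a.
have bB := @closed_statistics_bounded _ X mu n.+1 k b.
have hd0 : hausdorff_dist (@closed_statistics _ X mu n.+1 k.+1 a)
   (@closed_statistics _ X mu n.+1 k.+1 b) < eps / 2.
  have : weak_dist_term a b n k <= 0.
    by rewrite -ab0; apply: double_series_ge; exact: weak_dist_term_bound.
  rewrite /weak_dist_term pmulr_rle0 ?exprn_gt0 ?invr_gt0// => /le_lt_trans.
  by apply; rewrite divr_gt0.
have CA : @closed_statistics _ X mu n.+1 k.+1 a (@statistics _ X mu n.+1 k.+1 a A).
  by apply: subset_closure; exists A.
have [M CM AM] := hausdorff_dist_near bA bB CA hd0.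
have := CM (ball M (eps / 2)) (nbhsx_ballx _ _ _).
rewrite divr_gt0// => /(_ isT) [_ [[B pB <-]]].
rewrite -ball_normE /ball_/= => MB.
exists B => // p q r.
rewrite -!statisticsE.
set SA := statistics _ a A in AM *; set SB := statistics _ b B in MB *.
have SAB : `|SA - SB| < eps.
  by rewrite (le_lt_trans (ler_distD M _ _))// (splitr eps) ltrD.
apply: le_lt_trans SAB; rewrite [leRHS]/Num.norm/= mx_normrE.
apply: le_trans (le_bigmax _ _ (p, mxvec_index q r)) => /=.
by rewrite !mxE.
Qed.

Lemma weakly_contained_near a b n k (A : 'I_k.+1 -> set X) (eps : R) :
  weakly_contained a b -> measurable_partition A -> 0 < eps ->
  exists2 C, measurable_partition C & forall (p : 'I_n) q r,
    `|fine (mu (a (e p) @` A q `&` A r)) -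
      fine (mu (b (e p) @` C q `&` C r))| < eps.
Proof.
move=> ab pA eps0; have [mA tA _] := pA.
pose K : R := k.+1%:R.
have K1 : 1 <= K by rewrite ler1n.
pose c : R := 1 + 2 * ((1 + K * K) * K).
have c0 : 0 < c by rewrite /c; nra.
pose del := eps / c.
have del0 : 0 < del by rewrite divr_gt0.
pose F := [set 1%g] `|` [set e p | p in `I_n].
have finF : finite_set F.
  by rewrite finite_setU; split => //; apply: finite_image; exact: finite_II.
have [B [mB AB]] := ab _ A F del mA finF del0.
have act1_image (a' : mp_action G mu) (S : set X) : a' 1%g @` S = S.
  by rewrite mp_act_image invg1; apply/seteqP; split => x; rewrite /= mp_act1.
have AB1 i j : `|fine (mu (A i `&` A j)) - fine (mu (B i `&` B j))| < del.
  by have := AB 1%g (or_introl erefl) i j; rewrite !act1_image.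
have [|||C [pC BC CB]] := @near_partition _ _ _ mu k B (K * del) mB.
- move=> i j ij; have := AB1 i j.
  rewrite (_ : A i `&` A j = set0); last first.
    apply/seteqP; split => // x Aij.
    by move/eqP: ij; apply; apply: tA => //; exists x.
  rewrite measure0 sub0r normrN ger0_norm ?fine_ge0// => /ltW/le_trans; apply.
  nra.
- by nra.
- have sA := fine_measure_partition mu pA.
  have : \sum_(q < k.+1) (fine (mu (A q)) - del) <= \sum_(q < k.+1) fine (mu (B q)).
    apply: ler_sum => q _; have := AB1 q q; rewrite !setIid.
    by move=> /ltr_normlP[_]; lra.
  by rewrite sumrB sumr_const card_ord sA -[_ *+ k.+1]mulr_natl.
exists C => // p q r; have [mC _ _] := pC.
have mi (a' : mp_action G mu) g S : measurable S -> measurable (a' g @` S).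
  exact: measurable_mp_act_image.
have mim (a' : mp_action G mu) g S : measurable S ->
    fine (mu (a' g @` S)) = fine (mu S).
  by move=> mS; rewrite mp_act_image mp_act_preserving.
have ABp : `|fine (mu (a (e p) @` A q `&` A r)) -
    fine (mu (b (e p) @` B q `&` B r))| < del.
  by apply: AB; right; exists (p : nat) => //=.
have diff (S T : 'I_k.+1 -> set X) (s : R) : (forall i, measurable (S i)) ->
    (forall i, measurable (T i)) -> (forall i, fine (mu (S i `\` T i)) <= s) ->
    fine (mu ((b (e p) @` S q `&` S r) `\` (b (e p) @` T q `&` T r))) <= s + s.
  move=> mS mT ST; apply: (@le_trans _ _
    (fine (mu (b (e p) @` (S q `\` T q) `|` (S r `\` T r))))).
    apply: le_fine_measure.
    - by apply: measurableD; apply: measurableI => //; exact: mi.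
    - by apply: measurableU; [apply: mi|]; exact: measurableD.
    - move=> x [[bx Sx] nT]; have [Tx|nTx] := pselect (T r x); last by right.
      left; move: bx nT; rewrite !mp_act_image /= => bx nT; split => // Tq.
      by apply: nT; split => //; rewrite mp_act_image.
  apply: le_trans (fine_measureU_le _ _ _) _.
  - by apply: mi; exact: measurableD.
  - exact: measurableD.
  - by rewrite mim ?lerD//; exact: measurableD.
have BCp : `|fine (mu (b (e p) @` B q `&` B r)) -
    fine (mu (b (e p) @` C q `&` C r))| <= 2 * ((1 + K * K) * (K * del)).
  rewrite mulr_natl mulr2n; apply: fine_measure_dist_le.
  - by apply: measurableI => //; exact: mi.
  - by apply: measurableI => //; exact: mi.
  - apply: diff => // i; apply: le_trans (BC i) _.
    by rewrite ler_wpM2r//; [nra|rewrite -/K; nra].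
  - exact: diff.
rewrite (le_lt_trans (ler_distD (fine (mu (b (e p) @` B q `&` B r))) _ _))//.
apply: lt_le_trans (ltr_leD ABp BCp) _.
have -> : eps = del * c by rewrite /del divfK// gt_eqF.
by rewrite /c; nra.
Qed.

Lemma weakly_equivalent_dist0 a b :
  weakly_contained a b -> weakly_contained b a -> weak_dist a b = 0.
Proof.
have half a' b' n k M : weakly_contained a' b' ->
    @closed_statistics _ X mu n.+1 k.+1 a' M ->
    point_dist M (@closed_statistics _ X mu n.+1 k.+1 b') <= 0.
  move=> ab CM; apply/ler_addgt0Pr => eps eps0; rewrite add0r.
  have e2 : 0 < eps / 2 by rewrite divr_gt0.
  have [_ [[A pA <-]]] := CM (ball M (eps / 2)) (nbhsx_ballx _ _ e2).
  rewrite -ball_normE /ball_/= => MA.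
  have [B pB AB] := @weakly_contained_near a' b' n.+1 k A _ ab pA e2.
  have CB : @closed_statistics _ X mu n.+1 k.+1 b' (@statistics _ X mu n.+1 k.+1 b' B).
    by apply: subset_closure; exists B.
  apply: le_trans (point_dist_le M CB) _.
  rewrite (le_trans (ler_distD (statistics _ a' A) _ _))// (splitr eps) lerD//.
    exact: ltW.
  rewrite [leLHS]/Num.norm/= mx_normrE; apply: bigmax_le; first exact: ltW.
  move=> [p j] _; case/mxvec_indexP: j => q r /=.
  rewrite mxE [X in _ + X]mxE !statisticsE; exact/ltW/AB.
move=> ab ba; rewrite /weak_dist (_ : weak_dist_term a b = fun _ _ => 0) ?double_series0//.
apply/funext => n; apply/funext => k; apply/eqP; rewrite eq_le.
have /andP[-> _] := weak_dist_term_bound a b n k; rewrite andbT.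
rewrite /weak_dist_term mulr_ge0_le0 ?exprn_ge0 ?invr_ge0//.
by apply: hausdorff_dist_le => // M; exact: half.
Qed.

End distance.
End weak_distance.

Arguments statistics {G} e {R d X mu} n {k} a A.
Arguments closed_statistics {G} e {R d X mu} n k a.
Arguments weak_dist_term {G} e {R d X mu} a b n k.
Arguments weak_dist {G} e {R d X mu} a b.

Section metric.
Context (G : groupType) (e : {surj [set: nat] >-> [set: G]}) (R : realType).
Context d (X : measurableType d) (mu : probability X R).
Implicit Types a b : mp_action G mu.

Lemma weak_dist0_weakly_contained a b :
  weak_dist e a b = 0 -> weakly_contained a b.
Proof.
move=> ab0 n A F eps mA finF eps0.
have [N FN] : exists N, forall g, F g -> exists p : 'I_N.+1, e p = g.
  have /finite_seqP[s Fs] := finF.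
  have ex g : exists m, e m = g.
    by have [m _ <-] := @surj _ _ _ _ e g I; exists m.
  pose f g := sval (cid (ex g)).
  have fE g : e (f g) = g := svalP (cid (ex g)).
  exists (\max_(g <- s) f g)%N => g; rewrite Fs /= => gs.
  have fg : (f g < (\max_(g <- s) f g).+1)%N by rewrite ltnS leq_bigmax_seq.
  by exists (Ordinal fg); exact: fE.
pose k := #|{set 'I_n}|.-1.
have kE : k.+1 = #|{set 'I_n}| by rewrite prednK//; apply/card_gt0P; exists finset.set0.
pose code x : {set 'I_n} := [set i | x \in A i]%SET.
pose dec (q : 'I_k.+1) : {set 'I_n} := nth finset.set0 (enum {set 'I_n}) q.
have dec_inj : injective dec.
  move=> q r /eqP; rewrite /dec nth_uniq ?enum_uniq -?cardE -?kE//.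
  by move=> /eqP/val_inj.
have dec_surj S : exists q, dec q = S.
  have Sk : (enum_rank S < k.+1)%N by rewrite kE.
  by exists (Ordinal Sk); rewrite /dec/= nth_enum_rank.
pose P (q : 'I_k.+1) : set X := [set x | code x = dec q].
have pP : measurable_partition P.
  split.
  - move=> q; rewrite (_ : P q = \bigcap_(i in [set: 'I_n])
      (if i \in dec q then A i else ~` A i)).
      apply: fin_bigcap_measurable => // i _.
      by case: ifP => _ //; exact: measurableC.
    apply/seteqP; split => x.
      move=> Px i _; rewrite -Px inE; case: ifPn => [/set_mem//|xA].
      by move=> Ax; move: xA; rewrite mem_set.
    move=> Px; apply/setP => i; rewrite inE.
    have := Px i I; case: ifPn => [_ Ax|_ nAx]; first by rewrite mem_set.
    by rewrite memNset.
  - by move=> q r _ _ [x [Pq Pr]]; apply: dec_inj; rewrite -Pq -Pr.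
  - apply/seteqP; split=> // x _; have [q qx] := dec_surj (code x).
    by exists q.
pose I i : {set 'I_k.+1} := [set q | i \in dec q]%SET.
have AE i : A i = \bigcup_(q in [set` I i]) P q.
  apply/seteqP; split => x.
    move=> Ax; have [q qx] := dec_surj (code x); exists q => //=.
    by rewrite inE qx inE mem_set.
  move=> [q /=]; rewrite inE => iq Pq; move: iq.
  by rewrite -Pq inE => /set_mem.
pose del := eps / ((k.+1 * k.+1)%:R + 1).
have del0 : 0 < del by rewrite divr_gt0// ltr_wpDl.
have [Q pQ PQ] := @weak_dist0_near _ e _ _ _ _ a b N k P del ab0 pP del0.
exists (fun i => \bigcup_(q in [set` I i]) Q q); split.
  move=> i; apply: fin_bigcup_measurable; first exact: finite_finset.
  by move=> q _; case: pQ => + _ _; exact.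
move=> g Fg i j; have [p <-] := FN g Fg.
rewrite (AE i) (AE j) !statistics_additive// -sumrB.
under eq_bigr do rewrite -sumrB.
apply: (@le_lt_trans _ _ (\sum_(q in I i) \sum_(r in I j) del)).
  apply: le_trans (ler_norm_sum _ _ _) _; apply: ler_sum => q _.
  apply: le_trans (ler_norm_sum _ _ _) _; apply: ler_sum => r _.
  exact: ltW.
rewrite !sumr_const -mulrnA -[X in X < _]mulr_natr.
apply: (@le_lt_trans _ _ (eps / ((k.+1 * k.+1)%:R + 1) * (k.+1 * k.+1)%:R)).
  rewrite ler_pM2l// ler_nat; apply: leq_mul;
    by rewrite (leq_trans (max_card _))// card_ord.
rewrite mulrAC ltr_pdivrMr; last by rewrite ltr_wpDl.
by rewrite ltr_pM2l// ltrDl.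
Qed.

(* The enumeration is recorded in the type because the metric depends on it. *)
Definition weak_classes (_ : {surj [set: nat] >-> [set: G]}) : Type :=
  {eq_quot (@weakly_equivalent G R d X mu)}.

HB.instance Definition _ := Choice.on (weak_classes e).

Definition weak_class a : weak_classes e :=
  \pi_({eq_quot (@weakly_equivalent G R d X mu)}) a.

(* Independent of the representatives: see mdist_weak_class. *)
Definition class_dist (p q : weak_classes e) : R :=
  weak_dist e (repr p) (repr q).

Let class_distxx p : class_dist p p = 0.
Proof. exact: weak_distxx. Qed.

Let class_dist_positivity p q : class_dist p q = 0 -> p = q.
Proof.
move=> pq0; rewrite -[p]reprK -[q]reprK; apply/eqmodP/asboolP; split.
  exact: weak_dist0_weakly_contained.
by apply: weak_dist0_weakly_contained; rewrite weak_distC.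
Qed.

Let class_distC p q : class_dist p q = class_dist q p.
Proof. exact: weak_distC. Qed.

Let class_dist_triangle q p r :
  class_dist p r <= class_dist p q + class_dist q r.
Proof. exact: weak_dist_triangle. Qed.

HB.instance Definition _ := isMetric.Build R (weak_classes e)
  class_distxx class_dist_positivity class_distC class_dist_triangle.

Lemma weak_class_eqP a b : reflect
  (weakly_contained a b /\ weakly_contained b a)
  (weak_class a == weak_class b).
Proof.
apply: (iffP eqP) => [ab|ab]; last by apply/eqmodP/asboolP.
apply/asboolP; suff : weakly_equivalent a b by [].
by apply/eqmodP.
Qed.

Lemma mdist_weak_class a b :
  mdist (weak_class a) (weak_class b) = weak_dist e a b.
Proof.
have repr_dist a' : weak_dist e (repr (weak_class a')) a' = 0.
  have /eqP/weak_class_eqP[] : weak_class (repr (weak_class a')) = weak_class a'.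
    exact: reprK.
  exact: weakly_equivalent_dist0.
have le a1 a2 b1 b2 : weak_dist e a1 a2 = 0 -> weak_dist e b1 b2 = 0 ->
    weak_dist e a1 b1 <= weak_dist e a2 b2.
  move=> a0 b0; apply: le_trans (weak_dist_triangle e a2 a1 b1) _.
  rewrite a0 add0r; apply: le_trans (weak_dist_triangle e b2 a2 b1) _.
  by rewrite (weak_distC e b2) b0 addr0.
apply/eqP; rewrite [_ == _]eq_le; apply/andP; split; apply: le => //.
  by rewrite weak_distC.
by rewrite weak_distC.
Qed.

End metric.

Section convex_combination.
Context (G : groupType) (R : realType) d (X : measurableType d)
  (mu : probability X R).

(* Two copies of X, indexed by bool, of masses t (true) and 1 - t (false): see
   two_copies_measureE. *)
Definition two_copies_measure (t : {i01 R}) : set (bool * X) -> \bar R :=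
  (bernoulli_prob t%:num \x mu)%E.

HB.instance Definition _ t := Probability.on (two_copies_measure t).

Lemma two_copies_measureE (t : {i01 R}) (A : set (bool * X)) :
  measurable A ->
  two_copies_measure t A =
  (t%:num%:E * mu [set x | A (true, x)] +
   (1 - t%:num)%:E * mu [set x | A (false, x)])%E.
Proof.
move=> mA; rewrite /two_copies_measure /product_measure1.
rewrite integral_bernoulli_prob//=; first by rewrite !xsectionE.
by apply/andP; split.
Qed.

Variables (t : {i01 R}) (a b : mp_action G mu).

Definition two_copies_fun (g : G) (z : bool * X) : bool * X :=
  (z.1, if z.1 then a g z.2 else b g z.2).

Let two_copies_fun1 z : two_copies_fun 1%g z = z.
Proof. by case: z => -[] x; rewrite /two_copies_fun /= mp_act1. Qed.

Let two_copies_funM g h z :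
  two_copies_fun (g * h)%g z = two_copies_fun g (two_copies_fun h z).
Proof. by case: z => -[] x; rewrite /two_copies_fun /= mp_actM. Qed.

Let measurable_two_copies_fun g :
  measurable_fun [set: bool * X] (two_copies_fun g).
Proof.
apply/measurable_fun_pairP; split => /=.
  exact: measurable_fst.
apply: measurable_fun_ifT => //=.
- exact: measurableT_comp (measurable_mp_act a g) measurable_snd.
- exact: measurableT_comp (measurable_mp_act b g) measurable_snd.
Qed.

Let two_copies_fun_preserving g A : measurable A ->
  two_copies_measure t (two_copies_fun g @^-1` A) = two_copies_measure t A.
Proof.
move=> mA; rewrite !two_copies_measureE//; last first.
  by rewrite -[X in measurable X]setTI; exact: measurable_two_copies_fun.
have mx z : measurable [set x | A (z, x)].
  by have := measurable_xsection z mA; rewrite xsectionE.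
congr (_ * _ + _ * _)%E.
- exact: (mp_act_preserving a g (mx true)).
- exact: (mp_act_preserving b g (mx false)).
Qed.

Definition two_copies : mp_action G (two_copies_measure t) :=
  MPAction two_copies_fun1 two_copies_funM measurable_two_copies_fun
    two_copies_fun_preserving.

End convex_combination.

Section isomorphism.
Context (G : groupType) (R : realType).

(* The map f is an isomorphism of probability spaces (modulo null sets) that
   carries the action a to the action b almost everywhere. *)
Definition isomorphic_actions d (X : measurableType d) (mu : probability X R)
    d' (Y : measurableType d') (nu : probability Y R)
    (a : mp_action G mu) (b : mp_action G nu) : Prop :=
  exists (f : X -> Y) (h : Y -> X),
    [/\ measurable_fun [set: X] f /\ measurable_fun [set: Y] h,
        forall B, measurable B -> mu (f @^-1` B) = nu B,
        forall A, measurable A -> nu (h @^-1` A) = mu A,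
        {ae mu, forall x, h (f x) = x} /\ {ae nu, forall y, f (h y) = y} &
        forall g, {ae mu, forall x, f (a g x) = b g (f x)}].

End isomorphism.

(* The class of any action on X isomorphic to the disjoint union of
   representatives of p and q; the default p is only used if there is none. *)
Definition class_conv (G : groupType) (e : {surj [set: nat] >-> [set: G]})
    (R : realType) d (X : measurableType d) (mu : probability X R)
    (t : {i01 R}) (p q : weak_classes mu e) : weak_classes mu e :=
  xget p [set r | exists a b c : mp_action G mu,
    [/\ p = weak_class e a, q = weak_class e b, r = weak_class e c &
        isomorphic_actions c (two_copies t a b)]].

(* Main.v *)
Require Import Defs.
From mathcomp Require Import all_boot all_order all_algebra.
From mathcomp Require Import all_classical all_reals all_analysis.
From mathcomp Require Import measurable_realfun ring lra.
Set Implicit Arguments.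
Unset Strict Implicit.
Unset Printing Implicit Defensive.
Import Order.TTheory GRing.Theory Num.Theory.
Import numFieldNormedType.Exports.
Local Open Scope classical_set_scope.
Local Open Scope ring_scope.

(** The space of weak equivalence classes is modelled by sets of statistics.
    For an action a let S(a), for each size (n, k), be the set of arrays
    mu (e_p a A_q `&` A_r) given by the partitions A of X.  The distance of two
    classes compares the closures of these sets, so two actions with the same
    S have the same class.

    A partition of two copies of X is a pair of partitions of X, and the
    statistics of the disjoint union of a and b with weights t and 1 - t are
    the corresponding averages.  Hence, for an action c isomorphic to that
    union,

         S(c) = t S(a) + (1 - t) S(b)      (pointwise sums of sets)

    exactly, without closure (isomorphic_two_copies_statistics).  This makes
    everything elementary.  The axioms of a weak convex space are identities
    between such mixtures of sets in a vector space (mixture0, mixtureC,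
    mixtureA).  The Hausdorff distance of the closures of t P + (1 - t) Q and
    t' P' + (1 - t') Q' is at most
    d_H(P, P') + d_H(Q, Q') + 2 |t - t'| when the four sets lie in the unit
    ball, and summing over the sizes gives mdist_isomorphic_two_copies:

      d([c], [c']) <= d([a], [a']) + d([b], [b']) + 2 |t - t'|.

    With t = t' and equal classes on the right, this says that the class of c
    does not depend on any choice; in general it is the continuity of the
    operation.

    What remains is that the disjoint union of a and b really is isomorphic to
    an action on X (two_copies_transport), and this is where standardness and
    nonatomicity enter.  It suffices that X and the two copies of X are
    isomorphic modulo null sets, since an action of a countable group can then
    be carried over on an invariant conull set.  Both are isomorphic to the
    unit interval:
    - a countable family of sets separating points, read as ternary digits,
      embeds the space in the real line; points being null, composing with the
      distribution function gives a map f with uniform law on [0, 1]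
      (uniform_distr_fun), and no measurable set is lost up to null sets by
      this composition (distr_fun_preimage);
    - f is inverted almost everywhere without the Lusin-Souslin theorem: the
      family of sets can be chosen so that a point is recovered, as a limit in
      a complete metric space, from any measurable family of sets that
      contains the same indices (coding, standard_borel_coding).  The sets of
      the real line whose preimages under f agree almost everywhere with the
      coding sets are such a family. *)

(** * Decoding points of a standard Borel space *)

(** A coding family of sets separates points in a strong, measurable way: the
    point x can be computed measurably from a parameter w as soon as the
    sequence of truth values of x \in U n is a measurable function of w.  Such
    a family exists on every standard Borel space, and it induces one on two
    copies of the space. *)
Definition coding (R : realType) d (X : measurableType d)
    (U : nat -> set X) : Prop :=
  (forall n, measurable (U n)) /\
  forall B : nat -> set R, (forall n, measurable (B n)) ->
    exists2 h : R -> X, measurable_fun [set: R] h &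
      forall w x, (forall n, B n w <-> U n x) -> h w = x.

(** Decoding by successive approximation: w in B n k is to be read as
    membership of the unknown point in the ball of centre p k and radius
    1 / (n + 1). *)
Section limit_decoding.
Context (R : realType) (T : completePseudoMetricType R) (p : nat -> T).
Context d (W : measurableType d) (B : nat -> nat -> set W).
Hypothesis mB : forall n k, measurable (B n k).

Let r (n : nat) : R := n.+1%:R^-1.

Let r_gt0 n : 0 < r n. Proof. by rewrite invr_gt0. Qed.

Let r_le n m : (n <= m)%N -> r m <= r n.
Proof. by move=> nm; rewrite lef_pV2 ?posrE// ler_nat. Qed.

Let r_small e : 0 < e -> exists n, r n < e.
Proof.
move=> e0; exists (Num.truncn e^-1).
by rewrite invf_plt ?posrE//; exact: truncnS_gt.
Qed.

(** For fixed n these sets are disjoint, so that at most one centre is selected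
    at each scale. *)
Definition first_hit n k : set W := B n k `\` \bigcup_(j < k) B n j.

Let measurable_first_hit n k : measurable (first_hit n k).
Proof. by apply: measurableD => //; exact: bigcup_measurable. Qed.

Let first_hit_inj n w k l : first_hit n k w -> first_hit n l w -> k = l.
Proof.
move=> [Bk nBk] [Bl nBl]; case: (ltngtP k l) => // kl.
  by case: nBl; exists k.
by case: nBk; exists l.
Qed.

Let first_hitP n w k : B n k w -> exists2 j, first_hit n j w & B n j w.
Proof.
move=> Bk; have [j /asboolP Bj jmin] := @arg_minnP 'I_k.+1 ord_max
  (fun i => `[< B n i w >]) val (asboolT Bk).
exists j => //; split=> // -[l /= lj Bl].
have lk : (l < k.+1)%N by rewrite (ltn_trans lj).
by have := jmin (Ordinal lk) (asboolT Bl); rewrite /= leqNgt lj.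
Qed.

Definition hit_index w n : nat := xget 0%N [set k | first_hit n k w].

Let hit_indexE n w k : first_hit n k w -> hit_index w n = k.
Proof.
move=> hk; apply: (first_hit_inj _ hk); rewrite /hit_index.
by case: xgetP => [j ->//|/(_ k)].
Qed.

(** The parameters for which the selected centres are close enough to each
    other to form a Cauchy sequence with explicit modulus; only countably many
    conditions are involved, hence measurability. *)
Definition decodable : set W :=
  \bigcap_n \bigcap_(m in [set m | (n <= m)%N])
    \bigcup_k \bigcup_(l in [set l | ball (p k) (2 * r n) (p l)])
      (first_hit n k `&` first_hit m l).

Let measurable_decodable : measurable decodable.
Proof.
apply: bigcapT_measurable => n; apply: bigcap_measurable; first by exists n => /=.
move=> m _; apply: bigcupT_measurable => k; apply: bigcup_measurable => l _.
exact: measurableI.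
Qed.

Let decodable_hit w n : decodable w -> first_hit n (hit_index w n) w.
Proof.
by move=> /(_ n I n (leqnn n)) [k _ [l _ [hk _]]]; rewrite (hit_indexE hk).
Qed.

Let decodable_ball w n m : decodable w -> (n <= m)%N ->
  ball (p (hit_index w n)) (2 * r n) (p (hit_index w m)).
Proof.
move=> Dw nm; have [k _ [l b [hk hl]]] := Dw n I m nm.
by rewrite (hit_indexE hk) (hit_indexE hl).
Qed.

Definition limit_decode w : T := lim (p (hit_index w n) @[n --> \oo]).

Let decode_cvg w : decodable w -> cvg (p (hit_index w n) @[n --> \oo]).
Proof.
move=> Dw; apply: cauchy_cvg; apply: cauchy_exP => e e0.
have [n rn] := r_small (divr_gt0 e0 (ltr0Sn R 1)).
exists (p (hit_index w n)); exists n => // m /= nm.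
by apply: le_ball (decodable_ball Dw nm); lra.
Qed.

Let decode_ball w n : decodable w -> ball (p (hit_index w n)) (3 * r n) (limit_decode w).
Proof.
move=> Dw; have /cvg_ballP/(_ _ (r_gt0 n))[N _ Nr] := decode_cvg Dw.
have /= b1 := Nr (maxn N n) (leq_maxl _ _).
have b2 := decodable_ball Dw (leq_maxr N n).
have -> : 3 * r n = 2 * r n + r n by ring.
exact: ball_triangle b2 (ball_sym b1).
Qed.

(** The explicit modulus allows to test whether the limit lies in O on the
    centres alone: at some scale a ball around the selected centre that is
    known to contain the limit is included in O. *)
Lemma limit_decode_preimage (O : set T) : open O ->
  measurable (decodable `&` limit_decode @^-1` O).
Proof.
move=> oO.
rewrite (_ : _ `&` _ = decodable `&` \bigcup_n
  \bigcup_(k in [set k | ball (p k) (3 * r n) `<=` O]) first_hit n k).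
  apply: measurableI => //; apply: bigcupT_measurable => n.
  exact: bigcup_measurable.
apply/seteqP; split => w [Dw].
  move=> /= Ow; split => //.
  have /nbhs_ballP[e /= e0 eO] : nbhs (limit_decode w) O by exact: open_nbhs_nbhs.
  have [n rn] := r_small (divr_gt0 e0 (ltr0Sn R 5)).
  exists n => //; exists (hit_index w n) => /=; last exact: decodable_hit.
  move=> y ny; apply: eO; have b := decode_ball n Dw.
  by apply: le_ball (ball_triangle (ball_sym b) ny); lra.
move=> [n _ [k kO hk]]; split => //=; apply: kO.
by rewrite -(hit_indexE hk); exact: decode_ball.
Qed.

Lemma limit_decode_eq (x : T) w : hausdorff_space T ->
  (forall n, exists k, B n k w) -> (forall n k, B n k w -> ball (p k) (r n) x) ->
  decodable w /\ limit_decode w = x.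
Proof.
move=> hT exB Bx.
have hit n : exists2 k, first_hit n k w & ball (p k) (r n) x.
  by have [k /first_hitP[j hj Bj]] := exB n; exists j => //; exact: Bx.
have Dw : decodable w.
  move=> n _ m /= nm; have [k hk bk] := hit n; have [l hl bl] := hit m.
  exists k => //; exists l => //=.
  apply: le_ball (ball_triangle bk (ball_sym bl)).
  by have := r_le nm; lra.
split => //; apply: cvg_lim => //; apply/cvg_ballP => e e0.
have [n rn] := r_small e0.
exists n => // m /= nm; have [k hk bk] := hit m.
rewrite (hit_indexE hk); apply/ball_sym/(le_ball _ bk).
by rewrite (le_trans (r_le nm))// ltW.
Qed.

End limit_decoding.
Lemma countable_sub_range (T : pointedType) (D : set T) :
  countable D -> exists p : nat -> T, D `<=` range p.
Proof.
move=> /countable_injP[f fi].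
exists (fun n => xget point [set x | D x /\ f x = n]) => x Dx.
exists (f x) => //; case: xgetP => [y -> [Dy fxy]|/(_ x)]; last by case.
by apply: fi; rewrite ?inE.
Qed.

(** The coding sets are the balls with centres in a countable dense set and
    radii 1 / (n + 1).  Balls need not be open, whence the interiors. *)
Lemma standard_borel_coding (R : realType) d (X : measurableType d) :
  standard_borel R X -> exists U : nat -> set X, coding R U.
Proof.
move=> [T [f [hT [D cD dD] [g fK gK] mf]]].
have [p Dp] := countable_sub_range cD.
pose r (n : nat) : R := n.+1%:R^-1.
have r0 n : 0 < r n by rewrite invr_gt0.
pose V n k := f @^-1` (ball (p k) (r n))^°.
pose U m := if @unpickle (nat * nat)%type m is Some q then V q.1 q.2 else setT.
have UE n k : U (pickle (n, k)) = V n k by rewrite /U pickleK.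
have mo O : open O -> measurable (f @^-1` O).
  by move=> oO; apply/mf; exact: sub_sigma_algebra.
exists U; split=> [m|B mB].
  rewrite /U; case: unpickle => [q|//].
  by apply: mo; exact: open_interior.
pose B' (n k : nat) := B (pickle (n, k)).
pose h w := if w \in decodable p B' then g (limit_decode p B' w) else g point.
exists h => [_ A mA|w x Bx].
  rewrite setTI.
  have {mA} : <<s open >> (g @^-1` A).
    by apply/mf; rewrite -comp_preimage (_ : g \o f = id)//; exact/funext.
  (* The sets with measurable preimage form a sigma-algebra, which contains the
     open sets. *)
  pose m2 := [set O : set T | measurable (decodable p B' `&` limit_decode p B' @^-1` O)].
  have mD : measurable (decodable p B').
    have := @limit_decode_preimage R T p _ _ B' (fun n k => mB _) setT openT.
    by rewrite preimage_setT setIT.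
  have sigma_m2 : sigma_algebra setT m2.
    split.
    - by rewrite /m2/= preimage_set0 setI0.
    - move=> O mO; rewrite /m2/= setTD preimage_setC -setDE.
      rewrite (_ : _ `\` _ = decodable p B' `\`
        (decodable p B' `&` limit_decode p B' @^-1` O)).
        exact: measurableD.
      by rewrite setDIr setDv set0U.
    - move=> F mF; rewrite /m2/= preimage_bigcup setI_bigcupr.
      exact: bigcupT_measurable.
  move=> /(_ m2 (conj sigma_m2 _)) mA.
  have -> : h @^-1` A = (decodable p B' `&` limit_decode p B' @^-1` (g @^-1` A)) `|`
     (~` decodable p B' `&` [set _ | A (g point)]).
    apply/seteqP; split => w; rewrite /preimage/= /h.
      case: ifPn => [/set_mem|/negP wD] ?; [by left|right]; split => //.
      by move=> /mem_set.
    by case=> -[wD Aw]; [rewrite mem_set|rewrite memNset].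
  apply: measurableU.
    by apply: mA => O oO; apply: limit_decode_preimage => // n k; exact: mB.
  apply: measurableI; first exact: measurableC.
  have [Ag|nAg] := pselect (A (g point)).
    by rewrite (_ : [set _ | _] = setT)//; apply/seteqP; split.
  by rewrite (_ : [set _ | _] = set0)//; apply/seteqP; split.
have BV n k : B' n k w <-> V n k x by rewrite -UE; exact: Bx.
have [||wD dE] := @limit_decode_eq R T p _ _ B' (f x) w hT.
- move=> n.
  have [||y [/interior_subset yb /Dp[k _ pk]]] := dD ((ball (f x) (r n / 2))^°).
  - by exists (f x); apply: nbhsx_ballx; rewrite divr_gt0.
  - exact: open_interior.
  exists k; apply/BV; rewrite /V/=; apply/nbhs_ballP.
  exists (r n / 2) => /=; first by rewrite divr_gt0.
  by move=> z xz; rewrite pk; apply: le_ball (ball_triangle (ball_sym yb) xz); lra.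
- by move=> n k /BV /interior_subset.
by rewrite /h mem_set// dE fK.
Qed.

Section two_copies_coding.
Context (R : realType) d (X : measurableType d).

Definition two_copies_sets (U : nat -> set X) (n : nat) : set (bool * X) :=
  if n is m.+1 then snd @^-1` U m else fst @^-1` [set true].

Lemma two_copies_coding (U : nat -> set X) :
  coding R U -> coding R (two_copies_sets U).
Proof.
move=> [mU decU]; split=> [[|n]|B mB] /=.
- by rewrite -[X in measurable X]setTI; exact: measurable_fst.
- by rewrite -[X in measurable X]setTI; exact: measurable_snd.
have [h mh hU] := decU (fun n => B n.+1) (fun n => mB n.+1).
exists (fun w => (w \in B 0%N, h w)) => [|w [b x] Bx].
  apply/measurable_fun_pairP; split => //=.
  apply: (measurable_fun_bool true) => //; rewrite setTI.
  by rewrite (_ : _ @^-1` _ = B 0%N)//; apply/seteqP; split => w /=;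
    [move/set_mem|move/mem_set].
congr pair; last by apply: hU => n; exact: (Bx n.+1).
have := Bx 0%N; case: b {Bx} => /= Bx; first exact/mem_set/Bx.
by apply: memNset => /Bx.
Qed.

End two_copies_coding.
(** * Ternary expansions *)

(** Using only the digits 0 and 2 makes the expansion unique, so that each digit
    is a Borel function of the number. *)
Section ternary_code.
Context (R : realType).
Implicit Types b : nat -> bool.

Definition ternary_term b (n : nat) : R := 2 / 3 * 3^-1 ^+ n * (b n)%:R.

Definition ternary b : R := limn (series (ternary_term b)).

Let ternary_term_bound b n :
  0 <= ternary_term b n <= geometric (2 / 3) 3^-1 n.
Proof.
rewrite /ternary_term /=; set c := 2 / 3 * 3^-1 ^+ n.
have c0 : 0 <= c by rewrite !mulr_ge0.
by case: (b n); rewrite ?mulr1 ?mulr0 ?c0 ?lexx.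
Qed.

Let geometric_cvg : series (geometric (2 / 3) 3^-1) @ \oo --> (1 : R).
Proof.
have := @cvg_geometric_series R (2 / 3) 3^-1.
rewrite (_ : 2 / 3 * (1 - 3^-1)^-1 = 1); last by field.
by apply; rewrite ger0_norm ?invr_ge0// invf_lt1 ?ltr1n.
Qed.

Lemma is_cvg_ternary b : cvgn (series (ternary_term b)).
Proof.
apply: (@series_le_cvg _ _ (geometric (2 / 3) 3^-1)) (cvgP _ geometric_cvg).
- by move=> n; have /andP[] := ternary_term_bound b n.
- by move=> n; rewrite /= !mulr_ge0.
- by move=> n; have /andP[] := ternary_term_bound b n.
Qed.

Lemma ternary_ge0 b : 0 <= ternary b.
Proof.
apply: limr_ge; first exact: is_cvg_ternary.
apply: nearW => n; rewrite /series/= sumr_ge0// => k _.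
by have /andP[] := ternary_term_bound b k.
Qed.

Lemma ternary_le1 b : ternary b <= 1.
Proof.
rewrite -(cvg_lim _ geometric_cvg)//; apply: lim_series_le.
- exact: is_cvg_ternary.
- exact: cvgP geometric_cvg.
- by move=> n; have /andP[] := ternary_term_bound b n.
Qed.

Lemma ternary_shift b :
  ternary b = 2 / 3 * (b 0%N)%:R + ternary (fun n => b n.+1) / 3.
Proof.
apply/cvg_lim => //; rewrite -cvg_shiftS.
rewrite (_ : [sequence _]_n = fun n => 2 / 3 * (b 0%N)%:R +
    series (ternary_term (fun n => b n.+1)) n * 3^-1).
  apply: cvgD; first exact: cvg_cst.
  by apply: cvgM; [exact: is_cvg_ternary|exact: cvg_cst].
apply/funext => n; rewrite /series/= big_nat_recl//= /ternary_term.
rewrite expr0 mulr1 mulr_suml; congr (_ + _); apply: eq_bigr => k _.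
by rewrite exprS; ring.
Qed.

(** Shifts the digits of an expansion by one place, as ternary_stepE shows. *)
Definition ternary_step (r : R) : R := if 2 / 3 <= r then 3 * r - 2 else 3 * r.

Lemma ternary_digit b : (2 / 3 <= ternary b) = b 0%N.
Proof.
rewrite ternary_shift; have := ternary_ge0 (fun n => b n.+1).
have := ternary_le1 (fun n => b n.+1).
by case: (b 0%N) => /=; [lra|move=> h1 h0; apply/negbTE; rewrite -ltNge; lra].
Qed.

Lemma ternary_stepE b : ternary_step (ternary b) = ternary (fun n => b n.+1).
Proof.
rewrite /ternary_step ternary_digit (ternary_shift b).
by case: (b 0%N) => /=; lra.
Qed.

Lemma measurable_ternary_step : measurable_fun [set: R] ternary_step.
Proof.
apply: measurable_fun_ifT.
- by apply: measurable_fun_ler => //; exact: measurable_cst.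
- apply: measurable_funB; last exact: measurable_cst.
  by apply: measurable_funM; [exact: measurable_cst|exact: measurable_id].
- by apply: measurable_funM; [exact: measurable_cst|exact: measurable_id].
Qed.

Definition digit_set (n : nat) : set R := iter n ternary_step @^-1` `[2 / 3, +oo[.

Lemma measurable_digit_set n : measurable (digit_set n).
Proof.
rewrite -[X in measurable X]setTI; suff mi : measurable_fun setT (iter n ternary_step).
  by apply: mi.
elim: n => [|n IHn]; first exact: measurable_id.
exact: measurableT_comp measurable_ternary_step IHn.
Qed.

Lemma digit_setP b n : digit_set n (ternary b) <-> b n.
Proof.
rewrite /digit_set /= in_itv/= andbT; elim: n b => [|n IHn] b.
  by rewrite ternary_digit.
by rewrite iterSr ternary_stepE.
Qed.

Lemma ternary_code d (Y : measurableType d) (U : nat -> set Y) :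
  (forall n, measurable (U n)) ->
  exists2 phi : Y -> R, measurable_fun [set: Y] phi &
    forall n, U n = phi @^-1` digit_set n.
Proof.
move=> mU; exists (fun y => ternary (fun n => y \in U n)); last first.
  move=> n; apply/seteqP; split => y.
    by move=> Uy; apply/digit_setP/mem_set.
  by move/digit_setP/set_mem.
apply: (@measurable_fun_cvg _ _ _ _ (fun n y => series (ternary_term (fun n => y \in U n)) n)).
  move=> n; apply: measurable_sum => k.
  apply: measurable_funM; first exact: measurable_cst.
  have -> : (fun y => (y \in U k)%:R : R) = \1_(U k) by apply/funext => y; rewrite indicE.
  exact: measurable_indic.
by move=> y _; exact: is_cvg_ternary.
Qed.

End ternary_code.
(** * Maps with uniform distribution on the unit interval *)

Definition clamp (R : realType) (s : R) : R := Num.max 0 (Num.min 1 s).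

Definition uniform_on_unit (R : realType) d (Y : measurableType d)
    (m : probability Y R) (f : Y -> R) : Prop :=
  measurable_fun [set: Y] f /\ forall s, m (f @^-1` `]-oo, s]) = (clamp s)%:E.

Section uniformization.
Context (R : realType) d (Y : measurableType d) (m : probability Y R).

Lemma nondecreasing_bigcup_measure_le (F : nat -> set Y) (c : \bar R) :
  (forall n, measurable (F n)) -> nondecreasing_seq F ->
  (forall n, (m (F n) <= c)%E) -> (m (\bigcup_n F n) <= c)%E.
Proof.
move=> mF ndF Fc; have mU : measurable (\bigcup_n F n) by exact: bigcup_measurable.
have cF := nondecreasing_cvg_mu (mu := m) mF mU ndF.
rewrite -(cvg_lim _ cF)//; apply: lime_le; first exact: cvgP cF.
by apply: nearW => n; exact: Fc.
Qed.

Lemma measurable_preimage d' (Z : measurableType d') (f : Y -> Z) A :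
  measurable_fun [set: Y] f -> measurable A -> measurable (f @^-1` A).
Proof. by move=> mf mA; rewrite -[X in measurable X]setTI; exact: mf. Qed.

Variable phi : Y -> R.
Hypothesis mphi : measurable_fun [set: Y] phi.
Hypothesis phi_null : forall r, m (phi @^-1` [set r]) = 0%E.

Let mray i : measurable (phi @^-1` [set` Interval (BInfty R true) i]).
Proof. exact: measurable_preimage. Qed.

Definition distr_fun (r : R) : R := fine (m (phi @^-1` `]-oo, r])).

Let FE r : m (phi @^-1` `]-oo, r]) = (distr_fun r)%:E.
Proof. by rewrite fineK// fin_num_measure. Qed.

Let F_nd : nondecreasing_fun distr_fun.
Proof.
move=> r s rs; rewrite -lee_fin -!FE; apply: le_measure; rewrite ?inE//.
by move=> y /=; rewrite !in_itv/= => /le_trans; apply.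
Qed.

Let F_ge0 r : 0 <= distr_fun r. Proof. exact: fine_ge0. Qed.

Let F_le1 r : distr_fun r <= 1.
Proof. by rewrite -lee_fin -FE probability_le1. Qed.

Let F_left r c : (forall r', r' < r -> distr_fun r' <= c) -> distr_fun r <= c.
Proof.
move=> Fc; rewrite -lee_fin -FE.
have -> : phi @^-1` `]-oo, r] =
    (\bigcup_n phi @^-1` `]-oo, r - n.+1%:R^-1]) `|` phi @^-1` [set r].
  apply/seteqP; split => y /=; rewrite ?in_itv/=.
    rewrite le_eqVlt => /predU1P[->|yr]; [by right|left].
    exists (Num.truncn (r - phi y)^-1) => //=; rewrite in_itv/= lerBrDl -lerBrDr ltW//.
    by rewrite invf_plt ?posrE ?subr_gt0// truncnS_gt.
  case=> [[n _ /=]|->//]; rewrite in_itv/= => /le_trans; apply.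
  by rewrite gerBl.
apply: le_trans (measureU2 m _ _) _.
- exact: bigcup_measurable.
- exact: measurable_preimage.
rewrite [X in (_ + X)%E]phi_null adde0; apply: nondecreasing_bigcup_measure_le => //.
  move=> i j ij; apply/subsetPset => y /=; rewrite !in_itv/= => /le_trans; apply.
  by rewrite lerD2l lerN2 lef_pV2 ?posrE// ler_nat.
by move=> n; rewrite FE lee_fin; apply: Fc; rewrite gtrBl.
Qed.

Let F_right r c : (forall r', r < r' -> c <= distr_fun r') -> c <= distr_fun r.
Proof.
move=> cF; rewrite -lerN2 -(lerD2l 1) -lee_fin EFinB -FE.
rewrite -probability_setC// preimage_setC setCitvl.
have -> : phi @^-1` `]r, +oo[ = \bigcup_n phi @^-1` `]r + n.+1%:R^-1, +oo[.
  apply/seteqP; split => y /=; rewrite !in_itv/= ?andbT.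
    move=> ry; exists (Num.truncn (phi y - r)^-1) => //=; rewrite in_itv/= andbT.
    rewrite -ltrBrDl.
    by rewrite invf_plt ?posrE ?subr_gt0// truncnS_gt.
  move=> [n _ /=]; rewrite in_itv/= andbT; apply: lt_trans.
  by rewrite ltrDl.
apply: nondecreasing_bigcup_measure_le => //.
- by move=> n; exact: measurable_preimage.
- move=> i j ij; apply/subsetPset => y /=; rewrite !in_itv/= !andbT; apply: le_lt_trans.
  by rewrite lerD2l lef_pV2 ?posrE// ler_nat.
- move=> n; rewrite -setCitvl -preimage_setC probability_setC// FE -EFinB lee_fin.
  by rewrite lerD2l lerN2; apply: cF; rewrite ltrDl.
Qed.

Let F_not_ge s : s < 1 -> exists r, s < distr_fun r.
Proof.
move=> s1; apply: contrapT => /forallNP Fs.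
have : (m [set: Y] <= s%:E)%E.
  rewrite (_ : setT = \bigcup_n phi @^-1` `]-oo, n%:R]); last first.
    apply/seteqP; split => // y _; exists (Num.truncn (phi y)).+1 => //=.
    by rewrite in_itv/= ltW// truncnS_gt.
  apply: nondecreasing_bigcup_measure_le => //.
    move=> i j ij; apply/subsetPset => y /=; rewrite !in_itv/= => /le_trans; apply.
    by rewrite ler_nat.
  by move=> n; rewrite FE lee_fin leNgt; apply/negP; exact: Fs.
by rewrite probability_setT lee_fin leNgt s1.
Qed.

Let F_not_le s : 0 < s -> exists r, distr_fun r < s.
Proof.
move=> s0; apply: contrapT => /forallNP Fs.
have : (m [set: Y] <= (1 - s)%:E)%E.
  rewrite (_ : setT = \bigcup_n phi @^-1` `]- n%:R, +oo[); last first.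
    apply/seteqP; split => // y _; exists (Num.truncn (- phi y)).+1 => //=.
    by rewrite in_itv/= andbT ltrNl truncnS_gt.
  apply: nondecreasing_bigcup_measure_le.
  - by move=> n; exact: measurable_preimage.
  - move=> i j ij; apply/subsetPset => y /=; rewrite !in_itv/= !andbT; apply: le_lt_trans.
    by rewrite lerN2 ler_nat.
  - move=> n; rewrite -setCitvl -preimage_setC probability_setC// FE -EFinB lee_fin.
    by rewrite lerD2l lerN2 leNgt; apply/negP; exact: Fs.
by rewrite probability_setT lee_fin; lra.
Qed.

Let F_quantile s : 0 < s < 1 -> exists2 r, distr_fun r = s &
  forall r', r < r' -> s < distr_fun r'.
Proof.
move=> /andP[s0 s1]; have [r0 r0s] := F_not_le s0; have [r1 sr1] := F_not_ge s1.
pose S := [set r | distr_fun r <= s].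
have Sub r : ubound S r1.
  move=> x /= xs; rewrite leNgt; apply/negP => /ltW /F_nd.
  by rewrite leNgt (le_lt_trans xs).
have hS : has_sup S by split; [exists r0; exact: ltW|exists r1; exact: Sub].
exists (sup S).
  apply/eqP; rewrite eq_le; apply/andP; split.
    apply: F_left => r /(sup_gt (proj1 hS))[x /= xS rx].
    exact: le_trans (F_nd (ltW rx)) xS.
  apply: F_right => r Sr; rewrite ltW// ltNge; apply/negP => rs.
  by have := ub_le_sup (proj2 hS) rs; rewrite leNgt Sr.
move=> r Sr; rewrite ltNge; apply/negP => rs.
by have := ub_le_sup (proj2 hS) rs; rewrite leNgt Sr.
Qed.

Let mf : measurable_fun [set: Y] (distr_fun \o phi).
Proof. by apply: measurableT_comp => //; exact: nondecreasing_measurable. Qed.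

Let f_inner s : 0 < s < 1 -> m ((distr_fun \o phi) @^-1` `]-oo, s]) = s%:E.
Proof.
move=> /F_quantile[r rs Fr]; rewrite -[in RHS]rs -FE; congr (m _).
apply/seteqP; split => y /=; rewrite !in_itv/=.
  by move=> ys; rewrite leNgt; apply/negP => /Fr; rewrite ltNge ys.
by rewrite -rs => /F_nd.
Qed.

(** The probability integral transform: since phi has no atoms, its distribution
    function F takes each value s in ]0, 1[, say F r = s with r maximal, and
    then F (phi y) <= s means phi y <= r. *)
Lemma uniform_distr_fun : uniform_on_unit m (distr_fun \o phi).
Proof.
split=> // s; rewrite /clamp; have [s1|s1] := leP 1 s.
  rewrite max_r// (_ : _ @^-1` _ = setT) ?probability_setT//.
  by apply/seteqP; split => // y _ /=; rewrite in_itv/= (le_trans (F_le1 _)).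
have [s0|s0|<-] := ltgtP 0 s; last 2 first.
- rewrite (_ : _ @^-1` _ = set0) ?measure0//.
  apply/seteqP; split => // y /=; rewrite in_itv/= => ys.
  by have := le_lt_trans ys s0; rewrite ltNge F_ge0.
- apply/eqP; rewrite eq_le measure_ge0 andbT; apply/lee_addgt0Pr => e e0.
  rewrite add0e; have [e1|e1] := ltP e 1; last first.
    by rewrite (le_trans (probability_le1 _ _)) ?lee_fin//; exact: measurable_preimage.
  rewrite -(@f_inner e) ?e0//; apply: le_measure; rewrite ?inE.
  - exact: measurable_preimage.
  - exact: measurable_preimage.
  - by move=> y /=; rewrite !in_itv/= => /le_trans; apply; exact: ltW.
by rewrite f_inner// s0.
Qed.

(** For a ray V = ]-oo, r[ take B = ]-oo, F r]: the event phi < r is included in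
    F (phi) <= F r and both have probability F r.  The sets V with this property
    form a sigma-algebra. *)
Lemma distr_fun_preimage (V : set R) : measurable V ->
  exists2 B, measurable B &
    {ae m, forall y, V (phi y) <-> B (distr_fun (phi y))}.
Proof.
have mE : @measurable _ R = <<s @RGenInftyO.G R >> := RGenInftyO.measurableE R.
rewrite {1}mE.
pose H := [set V : set R | exists2 B, measurable B &
    {ae m, forall y, V (phi y) <-> B (distr_fun (phi y))}].
suff GH : @RGenInftyO.G R `<=` H.
  apply: (smallest_sub _ GH); split.
  - by exists set0 => //; apply: aeW.
  - move=> A [B mB AB]; exists (~` B); first exact: measurableC.
    by move: AB; apply: filterS => y AB; rewrite setTD /setC/=; split => h /AB.
  - move=> A AH.
    have /choice[B BP] : forall n, exists B : set R, measurable B /\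
        {ae m, forall y, A n (phi y) <-> B (distr_fun (phi y))}.
      by move=> n; have [B] := AH n; exists B.
    exists (\bigcup_n B n); first by apply: bigcupT_measurable => n; exact: (BP n).1.
    have : {ae m, forall y, forall n, A n (phi y) <-> B n (distr_fun (phi y))}.
      by apply/ae_foralln => n; exact: (BP n).2.
    by apply: filterS => y AB; split => -[n _ /AB Bn]; exists n.
move=> _ [r ->]; exists `]-oo, distr_fun r]%classic => //.
have mr := mray (BRight r).
have mFr : measurable ((distr_fun \o phi) @^-1` `]-oo, distr_fun r]).
  exact: measurable_preimage.
exists (((distr_fun \o phi) @^-1` `]-oo, distr_fun r] `\` phi @^-1` `]-oo, r])
  `|` phi @^-1` [set r]).
split.
- by apply: measurableU; [exact: measurableD|exact: measurable_preimage].
- apply/eqP; rewrite eq_le measure_ge0 andbT.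
  apply: le_trans (measureU2 _ _ _) _.
  + exact: measurableD.
  + exact: measurable_preimage.
  rewrite [X in (_ + X)%E]phi_null adde0 measureD//; last first.
    by rewrite ltey_eq fin_num_measure.
  rewrite setIidr; last by move=> y /=; rewrite !in_itv/= => /F_nd.
  rewrite [X in (X - _)%E](proj2 uniform_distr_fun) [X in (_ - X)%E]FE -EFinB lee_fin /clamp.
  by rewrite min_r// max_r// subrr.
- move=> y /=; rewrite !in_itv/=; apply: contra_notP => /not_orP[h1 h2].
  split=> [/ltW/F_nd//|yr].
  have : phi y <= r by apply: contrapT => nyr; exact: (h1 (conj yr nyr)).
  by rewrite le_eqVlt => /predU1P[].

Qed.

End uniformization.

Lemma uniform_on_unit_unique (R : realType) d (Y : measurableType d)
    (m : probability Y R) d' (Z : measurableType d') (n : probability Z R)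
    (f : Y -> R) (g : Z -> R) : uniform_on_unit m f -> uniform_on_unit n g ->
  forall B, measurable B -> m (f @^-1` B) = n (g @^-1` B).
Proof.
move=> [mf fE] [mg gE] B mB.
have fG r : m (f @^-1` `]r, +oo[) = n (g @^-1` `]r, +oo[).
  rewrite -setCitvl -!preimage_setC !probability_setC ?fE ?gE//; exact: measurable_preimage.
have := @measure_unique _ R _ (@RGenOInfty.G R) (fun k => `]- k%:R, +oo[%classic)
  (RGenOInfty.measurableE R) _ _ _ (pushforward m f) (pushforward n g) _ _ B mB.
apply=> //.
- move=> _ _ [x ->] [y ->]; exists (Num.max x y).
  apply/seteqP; split => r /=; rewrite !in_itv/= !andbT gt_max; first by move=> [-> ->].
  by move=> /andP[].
- by move=> k; exists (- k%:R).
- apply/seteqP; split => // y _; exists (Num.truncn (- y)).+1 => //=.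
  by rewrite in_itv/= andbT ltrNl truncnS_gt.
- by move=> _ [r ->]; exact: fG.
- move=> k; rewrite /= /pushforward ltey_eq fin_num_measure//.
  exact: measurable_preimage.
Qed.
(** * Nonatomic standard spaces are isomorphic to the unit interval *)

Section coding_points.
Context (R : realType) d (X : measurableType d) (U : nat -> set X).
Hypothesis cU : coding R U.

Lemma coding_inj x y : (forall n, U n x <-> U n y) -> x = y.
Proof.
move=> xy.
have [|h _ hB] := cU.2 (fun n => [set _ | U n x]).
  move=> n; have [Ux|nUx] := pselect (U n x).
    by rewrite (_ : [set _ | _] = setT)//; apply/seteqP; split.
  by rewrite (_ : [set _ | _] = set0)//; apply/seteqP; split.
by rewrite -(hB 0 x)// (hB 0 y).
Qed.

Lemma coding_measurable_set1 (x : X) : measurable [set x].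
Proof.
rewrite (_ : [set x] = \bigcap_n (if x \in U n then U n else ~` U n)).
  apply: bigcapT_measurable => n; case: ifP => _; first exact: cU.1.
  by apply: measurableC; exact: cU.1.
apply/seteqP; split => [_ -> n _|y Uy].
  by case: ifPn => [/set_mem//|/negP xU /mem_set].
apply: coding_inj => n; have := Uy n I; case: ifPn => [/set_mem xU yU|/negP xU yU].
  by split.
by split => // /mem_set.
Qed.

End coding_points.

Lemma nonatomic_set1 (R : realType) d (X : measurableType d)
    (mu : {measure set X -> \bar R}) x :
  nonatomic mu -> measurable [set x] -> mu [set x] = 0%E.
Proof.
move=> na mx; apply/eqP; rewrite eq_le measure_ge0 andbT leNgt; apply/negP => x0.
have [B [_ Bx /andP[B0 Bl]]] := na _ mx x0.
by have [E|E] := subset_set1 Bx; move: B0 Bl; rewrite E ?measure0 ltxx.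
Qed.

Lemma ae_measure_eq (R : realType) d (Y : measurableType d)
    (m : probability Y R) (A B : set Y) : measurable A -> measurable B ->
  {ae m, forall y, A y <-> B y} -> m A = m B.
Proof.
move=> mA mB [N [mN N0 AB]].
suff le (C D : set Y) : measurable C -> measurable D -> C `<=` D `|` N -> (m C <= m D)%E.
  apply/eqP; rewrite eq_le !le// => y Hy; apply: contrapT => /not_orP[H1 H2];
    by apply: H2; apply: AB => /= -[h1 h2]; apply: H1; auto.
move=> mC mD CDN; apply: (@le_trans _ _ (m (D `|` N))).
  by apply: le_measure; rewrite ?inE//; exact: measurableU.
rewrite (le_trans (measureU2 m mD mN))// [X in (_ + X <= _)%E]N0 adde0//.
Qed.

Lemma measure1_ae (R : realType) d (Y : measurableType d)
    (m : probability Y R) (A : set Y) : measurable A -> m A = 1%E ->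
  {ae m, forall y, A y}.
Proof.
move=> mA A1; exists (~` A); split=> //; first exact: measurableC.
by rewrite probability_setC// A1 subee.
Qed.

(** An isomorphism modulo null sets of (Y, m) with the uniform distribution on
    the unit interval; that f (h r) = r for almost every r is a consequence, see
    realization_cancel. *)
Definition realization (R : realType) d (Y : measurableType d)
    (m : probability Y R) (f : Y -> R) (h : R -> Y) : Prop :=
  [/\ uniform_on_unit m f, measurable_fun [set: R] h &
      {ae m, forall y, h (f y) = y}].

(** The set B n recovers the n-th coding set from the uniform map f, outside a
    null set; decoding the family B n therefore inverts f almost everywhere. *)
Lemma coding_realization (R : realType) d (Y : measurableType d)
    (m : probability Y R) (U : nat -> set Y) : coding R U ->
  (forall y, m [set y] = 0%E) -> exists f h, realization m f h.
Proof.
move=> cU m0; have [phi mphi Uphi] := ternary_code R cU.1.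
have phi_inj y z : phi y = phi z -> y = z.
  by move=> yz; apply: (coding_inj cU) => n; rewrite Uphi/= yz.
have phi_null r : m (phi @^-1` [set r]) = 0%E.
  have [[y yr]|no] := pselect (exists y, phi y = r).
    rewrite (_ : _ @^-1` _ = [set y]) ?m0//; apply/seteqP; split => z /=.
      by rewrite -yr => /phi_inj.
    by move=> ->.
  rewrite (_ : _ @^-1` _ = set0) ?measure0//.
  by apply/seteqP; split => // y yr; apply: no; exists y.
have /choice[B BP] : forall n, exists B : set R, measurable B /\
    {ae m, forall y, U n y <-> B (distr_fun m phi (phi y))}.
  move=> n; have [B mB VB] := distr_fun_preimage mphi phi_null (@measurable_digit_set R n).
  by exists B; split=> //; rewrite Uphi.
have [h mh hU] := cU.2 B (fun n => (BP n).1).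
exists (distr_fun m phi \o phi), h; split => //; first exact: uniform_distr_fun.
have := (ae_foralln (fun n => (BP n).2)); apply: filterS => y By.
by apply: hU => n; split => /By.
Qed.

Section realizations_isomorphic.
Context (R : realType) d (X : measurableType d) (mu : probability X R).
Context d' (Y : measurableType d') (nu : probability Y R).
Variables (f : X -> R) (h : R -> X) (f' : Y -> R) (h' : R -> Y).
Hypotheses (fh : realization mu f h) (fh' : realization nu f' h').

Lemma realization_measurable : measurable_fun [set: X] (h' \o f).
Proof. by case: fh fh' => -[mf _] _ _ [_ mh' _]; exact: measurableT_comp mh' mf. Qed.

Lemma realization_preserving B : measurable B -> mu ((h' \o f) @^-1` B) = nu B.
Proof.
case: fh fh' => uf _ _ [uf' mh' h'f'] mB.
have mhB : measurable (h' @^-1` B) by exact: measurable_preimage.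
rewrite comp_preimage (uniform_on_unit_unique uf uf' mhB).
apply: ae_measure_eq => //; first exact: measurable_preimage uf'.1 mhB.
by move: h'f'; apply: filterS => y /= ->.
Qed.

(** The set of r fixed by f' \o h' has full uniform measure because its preimage
    under f' contains almost every y; hence f x lies in it for almost every
    x. *)
Lemma realization_cancel : {ae mu, forall x, h (f' ((h' \o f) x)) = x}.
Proof.
case: fh fh' => uf _ hf [uf' mh' h'f'].
pose E := [set r | f' (h' r) = r].
have mE : measurable E.
  rewrite (_ : E = (fun r => f' (h' r) - r) @^-1` [set 0]).
    apply: measurable_preimage => //; apply: measurable_funB => //.
    exact: measurableT_comp uf'.1 mh'.
  by apply/seteqP; split => r /=; [move=> ->; rewrite subrr|move/eqP; rewrite subr_eq0 => /eqP].
have fE : {ae mu, forall x, E (f x)}.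
  apply: measure1_ae; first exact: measurable_preimage uf.1 mE.
  rewrite -(probability_setT nu) (uniform_on_unit_unique uf uf' mE).
  apply: ae_measure_eq => //; first exact: measurable_preimage uf'.1 mE.
  by move: h'f'; apply: filterS => y /= yE; split=> // _; rewrite /E/= yE.
by move: hf fE; apply: filterS2 => x hf; rewrite /E /= => ->.
Qed.

End realizations_isomorphic.

Lemma two_copies_set1 (R : realType) d (X : measurableType d)
    (mu : probability X R) (t : {i01 R}) (z : bool * X) :
  measurable [set z] -> (forall x, mu [set x] = 0%E) ->
  two_copies_measure mu t [set z] = 0%E.
Proof.
move=> mz mu0; rewrite two_copies_measureE//; case: z mz => b x _.
have sect c : mu [set y | [set (b, x)] (c, y)] = 0%E.
  have [->|cb] := eqVneq c b.
    rewrite (_ : [set _ | _] = [set x]) ?mu0//.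
    by apply/seteqP; split => y /=; [case|move=> ->].
  rewrite (_ : [set _ | _] = set0) ?measure0//.
  by apply/seteqP; split => y //= -[/eqP]; rewrite (negbTE cb).
by rewrite !sect !mule0 adde0.
Qed.

Lemma two_copies_realization (R : realType) d (X : measurableType d)
    (mu : probability X R) (t : {i01 R}) :
  standard_borel R X -> nonatomic mu ->
  exists f h f' h', realization mu f h /\ realization (two_copies_measure mu t) f' h'.
Proof.
move=> /standard_borel_coding[U cU] na.
have mu0 x : mu [set x] = 0%E.
  by apply: nonatomic_set1 => //; exact: coding_measurable_set1 cU x.
have cU2 := two_copies_coding cU.
have [f [h fh]] := coding_realization cU mu0.
have [|f' [h' fh']] := @coding_realization _ _ _ (two_copies_measure mu t) _ cU2.
  by move=> z; apply: two_copies_set1 => //; exact: coding_measurable_set1 cU2 z.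
by exists f, h, f', h'.
Qed.

(** * Carrying an action over to an isomorphic space *)

Lemma ae_comp (R : realType) d (X : measurableType d) (mu : probability X R)
    d' (Y : measurableType d') (nu : probability Y R) (f : X -> Y) (P : Y -> Prop) :
  measurable_fun [set: X] f -> (forall B, measurable B -> mu (f @^-1` B) = nu B) ->
  {ae nu, forall y, P y} -> {ae mu, forall x, P (f x)}.
Proof.
move=> mf fmu [N [mN N0 PN]]; exists (f @^-1` N); split.
- exact: measurable_preimage.
- by rewrite fmu.
- by move=> x; exact: PN.
Qed.

(** Countability of the group is what makes the intersection of the translates
    of a conull set conull. *)
Lemma ae_invariant_core (G : groupType) (e : {surj [set: nat] >-> [set: G]})
    (R : realType) d (Y : measurableType d) (nu : probability Y R)
    (b : mp_action G nu) (P : Y -> Prop) : {ae nu, forall y, P y} ->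
  exists S : set Y, [/\ measurable S, {ae nu, forall y, S y},
    forall g y, S y -> S (b g y) & S `<=` P].
Proof.
move=> [N [mN N0 PN]].
pose S := \bigcap_n b (e n) @^-1` ~` N.
have SP y : S y <-> forall g, ~ N (b g y).
  split=> [Sy g|Ny n _]; last exact: Ny.
  by have [n _ <-] := @surj _ _ _ _ e g I; exact: Sy.
exists S; split.
- apply: bigcapT_measurable => n.
  by apply: measurable_preimage; [exact: measurable_mp_act|exact: measurableC].
- have nN : {ae nu, forall y, ~ N y} by exists N; split => // y /= /contrapT.
  have : {ae nu, forall y, forall n, ~ N (b (e n) y)}.
    apply/ae_foralln => n; apply: (ae_comp _ _ nN); first exact: measurable_mp_act.
    by move=> B; exact: mp_act_preserving.
  by apply: filterS => y Ny n _; exact: Ny.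
- by move=> g y /SP Sy; apply/SP => k; rewrite -mp_actM.
- move=> y /SP/(_ 1%g); rewrite mp_act1 => Ny; apply: contrapT => Py.
  by apply: Ny; exact: PN.
Qed.

(** Actions are everywhere defined, so the transported action is set to be
    trivial outside an invariant conull set on which f and h are mutually
    inverse. *)
Lemma transport_action (G : groupType) (e : {surj [set: nat] >-> [set: G]})
    (R : realType) d (X : measurableType d) (mu : probability X R)
    d' (Y : measurableType d') (nu : probability Y R) (b : mp_action G nu)
    (f : X -> Y) (h : Y -> X) :
  measurable_fun [set: X] f -> measurable_fun [set: Y] h ->
  (forall B, measurable B -> mu (f @^-1` B) = nu B) ->
  (forall A, measurable A -> nu (h @^-1` A) = mu A) ->
  {ae mu, forall x, h (f x) = x} -> {ae nu, forall y, f (h y) = y} ->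
  exists c : mp_action G mu, isomorphic_actions c b.
Proof.
move=> mf mh fmu hnu hf fh; have [M [mM M0 hfM]] := hf.
have nM : {ae mu, forall x, ~ M x} by exists M; split => // x /= /contrapT.
have [|S [mS aeS invS SP]] := @ae_invariant_core G e _ _ _ nu b
    (fun y => f (h y) = y /\ ~ M (h y)).
  by move: fh (ae_comp mh hnu nM); apply: filterS2.
pose E := f @^-1` S `&` ~` M.
have mE : measurable E.
  by apply: measurableI; [exact: measurable_preimage|exact: measurableC].
have aeE : {ae mu, forall x, E x}.
  by move: (ae_comp mf fmu aeS) nM; apply: filterS2.
have hfE x : E x -> h (f x) = x.
  by move=> [_ Mx]; apply: contrapT => hfx; apply: Mx; exact: hfM.
have hE y : S y -> E (h y).
  by move=> Sy; have [fhy Mhy] := SP _ Sy; split => //; rewrite /preimage/= fhy.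
pose c g x := if x \in E then h (b g (f x)) else x.
have cE g x : E x -> c g x = h (b g (f x)) by move=> Ex; rewrite /c mem_set.
have c1 x : c 1%g x = x.
  by rewrite /c; case: ifPn => // /set_mem Ex; rewrite mp_act1 hfE.
have cM g k x : c (g * k)%g x = c g (c k x).
  rewrite /c; case: ifPn => [/set_mem Ex|xE]; last by rewrite (negbTE xE).
  have Sk : S (b k (f x)) by apply: invS; case: Ex.
  by rewrite mem_set; [rewrite mp_actM (SP _ Sk).1|exact: hE].
have mhbf g : measurable_fun [set: X] (fun x => h (b g (f x))).
  by apply: measurableT_comp mh _; apply: measurableT_comp (measurable_mp_act b g) _.
have mc g : measurable_fun [set: X] (c g).
  apply: measurable_fun_ifT => //; apply: (measurable_fun_bool true) => //.
  rewrite setTI (_ : _ @^-1` _ = E)//.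
  by apply/seteqP; split => x /=; [move/set_mem|move/mem_set].
have pc g A : measurable A -> mu (c g @^-1` A) = mu A.
  move=> mA; have mhA : measurable (h @^-1` A) by exact: measurable_preimage.
  rewrite -(hnu A mA) -(mp_act_preserving b g mhA) -fmu; last first.
    exact: measurable_preimage (measurable_mp_act b g) mhA.
  apply: ae_measure_eq; [exact: measurable_preimage|exact: measurable_preimage (mhbf g) _|].
  by move: aeE; apply: filterS => x Ex; rewrite /preimage/= cE.
exists (MPAction c1 cM mc pc), f, h; split => //= g.
by move: aeE; apply: filterS => x Ex; rewrite cE// (SP _ (invS g _ Ex.1)).1.
Qed.

Lemma two_copies_transport (G : groupType) (e : {surj [set: nat] >-> [set: G]})
    (R : realType) d (X : measurableType d) (mu : probability X R)
    (t : {i01 R}) (a b : mp_action G mu) :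
  standard_borel R X -> nonatomic mu ->
  exists c : mp_action G mu, isomorphic_actions c (two_copies t a b).
Proof.
move=> sX na; have [f [h [f' [h' [fh fh']]]]] := two_copies_realization t sX na.
apply: (transport_action e (two_copies t a b)).
- exact: realization_measurable fh fh'.
- exact: realization_measurable fh' fh.
- exact: realization_preserving fh fh'.
- exact: realization_preserving fh' fh.
- exact: realization_cancel fh fh'.
- exact: realization_cancel fh' fh.
Qed.
(** * Statistics of partitions *)

Section partition_statistics.
Context (G : groupType) (e : nat -> G) (R : realType).

Definition partition_statistics d (X : measurableType d) (mu : probability X R)
    (n k : nat) (a : mp_action G mu) : set 'M[R]_(n, k * k) :=
  [set statistics e n a A | A in @measurable_partition _ X k].
Arguments partition_statistics {d X mu} n k a.

Lemma measurable_partition_preimage d (X : measurableType d)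
    d' (Y : measurableType d') (f : X -> Y) k (B : 'I_k -> set Y) :
  measurable_fun [set: X] f -> measurable_partition B ->
  measurable_partition (fun i => f @^-1` B i).
Proof.
move=> mf [mB tB BT]; split.
- by move=> i; exact: measurable_preimage.
- by move=> i j _ _ [x [Bi Bj]]; apply: tB => //; exists (f x).
- by rewrite -preimage_bigcup BT.
Qed.

(** The statistics are literally the same: the preimages of the pieces of a
    partition under f, respectively h, form a partition with equal statistics,
    almost everywhere equivariance being enough to compare measures. *)
Lemma isomorphic_partition_statistics d (X : measurableType d)
    (mu : probability X R) d' (Y : measurableType d') (nu : probability Y R)
    (c : mp_action G mu) (b : mp_action G nu) n k :
  isomorphic_actions c b ->
  partition_statistics n k c = partition_statistics n k b.
Proof.
move=> [f [h [[mf mh] fmu hnu [hf fh] cb]]].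
have mI (d1 : measure_display) (Z : measurableType d1) (rho : probability Z R)
    (a : mp_action G rho) g (S T : set Z) : measurable S -> measurable T ->
    measurable (a g @` S `&` T).
  by move=> mS mT; apply: measurableI => //; exact: measurable_mp_act_image.
apply/seteqP; split => _ [A pA <-]; have [mA _ _] := pA.
  exists (fun i => h @^-1` A i); first exact: measurable_partition_preimage.
  apply/matrixP => p j; case/mxvec_indexP: j => q r; rewrite !statisticsE.
  have mhA i : measurable (h @^-1` A i) by exact: measurable_preimage.
  rewrite -fmu; last exact: mI.
  congr fine; apply: ae_measure_eq; [by apply: measurable_preimage => //; exact: mI|exact: mI|].
  set g := (e p)^-1%g.
  have hfc : {ae mu, forall x, h (f (c g x)) = c g x}.
    apply: (ae_comp _ _ hf); first exact: measurable_mp_act.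
    by move=> B; exact: mp_act_preserving.
  move: hf hfc (cb g); apply: filterS3 => x hfx hfcx cbx.
  by rewrite !mp_act_image /preimage/= -/g -cbx hfcx hfx.
exists (fun i => f @^-1` A i); first exact: measurable_partition_preimage.
apply/matrixP => p j; case/mxvec_indexP: j => q r; rewrite !statisticsE.
have mfA i : measurable (f @^-1` A i) by exact: measurable_preimage.
rewrite -fmu; last exact: mI.
congr fine; apply: ae_measure_eq; [exact: mI|by apply: measurable_preimage => //; exact: mI|].
move: (cb (e p)^-1%g); apply: filterS => x cbx.
by rewrite !mp_act_image /preimage/= cbx.
Qed.

Definition mixture (V : lmodType R) (t : R) (P Q : set V) : set V :=
  [set t *: u + (1 - t) *: v | u in P & v in Q].

(** A partition of the two copies is an arbitrary pair of partitions of X. *)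
Lemma two_copies_partition_statistics d (X : measurableType d)
    (mu : probability X R) (t : {i01 R}) (a b : mp_action G mu) n k :
  partition_statistics n k (two_copies t a b) =
  mixture t%:num (partition_statistics n k a) (partition_statistics n k b).
Proof.
have stE (A : 'I_k -> set (bool * X)) : (forall i, measurable (A i)) ->
    statistics e n (two_copies t a b) A =
    t%:num *: statistics e n a (fun i => pair true @^-1` A i) +
    (1 - t%:num) *: statistics e n b (fun i => pair false @^-1` A i).
  move=> mA; apply/matrixP => p j; case/mxvec_indexP: j => q r.
  rewrite [RHS]mxE [X in _ = X + _]mxE [X in _ = _ + X]mxE !statisticsE.
  rewrite [X in fine X = _]two_copies_measureE; last first.
    by apply: measurableI => //; exact: measurable_mp_act_image.
  have mp c q' : measurable (pair c @^-1` A q').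
    exact: measurable_preimage (measurable_pair1 c) (mA q').
  have mI (c : bool) (a' : mp_action G mu) :
      measurable (a' (e p) @` (pair c @^-1` A q) `&` pair c @^-1` A r).
    by apply: measurableI => //; exact: measurable_mp_act_image.
  rewrite (_ : [set x | _ (true, x)] =
    a (e p) @` (pair true @^-1` A q) `&` pair true @^-1` A r); last first.
    by rewrite !mp_act_image.
  rewrite (_ : [set x | _ (false, x)] =
    b (e p) @` (pair false @^-1` A q) `&` pair false @^-1` A r); last first.
    by rewrite !mp_act_image.
  by rewrite fineD ?fineM// ?fin_numM ?fin_num_measure.
apply/seteqP; split => [_ [A pA <-]|_ [_ [B pB <-] [_ [C pC <-] <-]]].
  have [mA _ _] := pA; rewrite stE//.
  have pS c : measurable_partition (fun i => pair c @^-1` A i).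
    exact: measurable_partition_preimage (measurable_pair1 c) pA.
  exists (statistics e n a (fun i => pair true @^-1` A i)).
    by exists (fun i => pair true @^-1` A i).
  exists (statistics e n b (fun i => pair false @^-1` A i)) => //.
  by exists (fun i => pair false @^-1` A i).
have [mB tB BT] := pB; have [mC tC CT] := pC.
pose A i := [set z : bool * X | if z.1 then B i z.2 else C i z.2].
have mA i : measurable (A i).
  rewrite (_ : A i = (fst @^-1` [set true] `&` snd @^-1` B i) `|`
      (fst @^-1` [set false] `&` snd @^-1` C i)).
    have mfst c : measurable (@fst bool X @^-1` [set c]).
      exact: measurable_preimage measurable_fst _.
    have msnd S : measurable S -> measurable (@snd bool X @^-1` S).
      exact: measurable_preimage measurable_snd.
    by apply: measurableU; apply: measurableI => //; exact: msnd.
  apply/seteqP; split => -[[] x] /=; rewrite /A/=; by [left|right|case=> -[]].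
exists A; last by rewrite stE.
split => //.
- by move=> i j _ _ [[[] x] [Ai Aj]]; [apply: tB|apply: tC] => //; exists x.
- apply/seteqP; split => // -[[] x] _.
    by have [i _ Bi] : (\bigcup_i B i) x by [rewrite BT]; exists i.
  by have [i _ Ci] : (\bigcup_i C i) x by [rewrite CT]; exists i.
Qed.

End partition_statistics.
Arguments partition_statistics {G} e {R d X mu} n k a.
(** * Distance between mixtures *)

Section mixture_distance.
Context (R : realType) (V : normedModType R).
Implicit Types (P Q : set V) (t : R).

Let bounded_closure P := closure P !=set0 /\ forall x, closure P x -> `|x| <= 1.

Lemma closure_near P x r : closure P x -> 0 < r -> exists2 y, P y & `|x - y| < r.
Proof.
move=> /(_ (ball x r) (nbhsx_ballx _ _ _)) + r0 => /(_ r0)[y [Py]].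
by rewrite -ball_normE; exists y.
Qed.

Let close_in_closure P P' x r : bounded_closure P -> bounded_closure P' -> P x ->
  hausdorff_dist (closure P) (closure P') < r -> exists2 y, P' y & `|x - y| < r.
Proof.
move=> bP bP' Px Hr; set H := hausdorff_dist _ _ in Hr.
have rH : 0 < (r - H) / 2 by rewrite divr_gt0// subr_gt0.
have [|y cy xy] := @hausdorff_dist_near _ _ _ _ _ x (H + (r - H) / 2)
    bP bP' (subset_closure Px).
  by rewrite ltrDl.
have [z Pz yz] := closure_near cy rH.
exists z => //; apply: le_lt_trans (ler_distD y _ _) _.
by have := ltrD xy yz; lra.
Qed.

(** For u, v close to u', v', write
      t u + (1 - t) v - (t' u' + (1 - t') v')
        = t (u - u') + (1 - t) (v - v') + (t - t') (u' - v'),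
    where u' - v' has norm at most 2. *)
Lemma mixture_hausdorff_dist t t' P Q P' Q' : 0 <= t <= 1 -> 0 <= t' <= 1 ->
  bounded_closure P -> bounded_closure Q ->
  bounded_closure P' -> bounded_closure Q' ->
  hausdorff_dist (closure (mixture t P Q)) (closure (mixture t' P' Q')) <=
  hausdorff_dist (closure P) (closure P') +
  hausdorff_dist (closure Q) (closure Q') + 2 * `|t - t'|.
Proof.
have half s s' A B A' B' x : 0 <= s <= 1 ->
    bounded_closure A -> bounded_closure B ->
    bounded_closure A' -> bounded_closure B' -> closure (mixture s A B) x ->
    point_dist x (closure (mixture s' A' B')) <=
    hausdorff_dist (closure A) (closure A') +
    hausdorff_dist (closure B) (closure B') + 2 * `|s - s'|.
  move=> /andP[s0 s1] bA bB bA' bB' cx.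
  apply/ler_addgt0Pr => r r0; have r3 : 0 < r / 3 by rewrite divr_gt0.
  have [_ [u Au [v Bv <-]] xuv] := closure_near cx r3.
  set HA := hausdorff_dist _ (closure A'); set HB := hausdorff_dist _ (closure B').
  have [u' Au' uu'] : exists2 u', A' u' & `|u - u'| < HA + r / 3.
    by apply: close_in_closure bA bA' Au _; rewrite ltrDl.
  have [v' Bv' vv'] : exists2 v', B' v' & `|v - v'| < HB + r / 3.
    by apply: close_in_closure bB bB' Bv _; rewrite ltrDl.
  have u'1 : `|u'| <= 1 by apply: bA'.2; exact: subset_closure.
  have v'1 : `|v'| <= 1 by apply: bB'.2; exact: subset_closure.
  apply: le_trans (@point_dist_le _ _ x (s' *: u' + (1 - s') *: v') _ _) _.
    by apply: subset_closure; exists u' => //; exists v'.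
  apply: le_trans (ler_distD (s *: u + (1 - s) *: v) _ _) _.
  have -> : s *: u + (1 - s) *: v - (s' *: u' + (1 - s') *: v') =
      (s *: (u - u') + (1 - s) *: (v - v')) + (s - s') *: (u' - v').
    have split_scale (w w' : R) (y z : V) : w *: y - w' *: z = w *: (y - z) + (w - w') *: z.
      by rewrite scalerBr scalerBl addrA subrK.
    rewrite opprD addrACA !split_scale [(s - s') *: (u' - v')]scalerBr.
    rewrite [RHS]addrACA -scaleNr; congr (_ + (_ + _ *: _)); ring.
  apply: le_trans (lerD (ltW xuv) (ler_normD _ _)) _.
  have n1 : `|s *: (u - u') + (1 - s) *: (v - v')| <=
      s * (HA + r / 3) + (1 - s) * (HB + r / 3).
    apply: le_trans (ler_normD _ _) _; rewrite !normrZ ger0_norm//.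
    rewrite ger0_norm ?subr_ge0//; apply: lerD; apply: ler_wpM2l => //.
    - exact: ltW.
    - by rewrite subr_ge0.
    - exact: ltW.
  have n2 : `|(s - s') *: (u' - v')| <= `|s - s'| * 2.
    rewrite normrZ ler_wpM2l// (le_trans (ler_normB _ _))//; lra.
  have HA0 : 0 <= HA by exact: hausdorff_dist_ge0 bA bA'.
  have HB0 : 0 <= HB by exact: hausdorff_dist_ge0 bB bB'.
  have n3 : s * (HA + r / 3) + (1 - s) * (HB + r / 3) <= HA + HB + r / 3 by nra.
  lra.
move=> t01 t'01 bP bQ bP' bQ'; apply: hausdorff_dist_le => [|x|x].
- by rewrite !addr_ge0 ?mulr_ge0//;
    [exact: hausdorff_dist_ge0 bP bP'|exact: hausdorff_dist_ge0 bQ bQ'].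
- exact: half.
- by rewrite distrC (hausdorff_distC (closure P)) (hausdorff_distC (closure Q)); exact: half.
Qed.

End mixture_distance.

Lemma double_series_geometric (R : realType) (c : R) :
  double_series (fun n k => c * (2^-1 ^+ n * 2^-1 ^+ k)) = 4 * c.
Proof.
have geo (b : R) : limn (series (geometric b (2^-1 : R))) = b * 2.
  apply/cvg_lim => //; have := @cvg_geometric_series R b 2^-1.
  rewrite (_ : (1 - 2^-1)^-1 = 2); last by field.
  by apply; rewrite ger0_norm ?invr_ge0// invf_lt1 ?ltr1n.
rewrite /double_series (_ : (fun n => _) = geometric (c * 2) 2^-1) ?geo; first by ring.
apply/funext => n /=; rewrite (_ : (fun k => _) = geometric (c * 2^-1 ^+ n) 2^-1).
  by rewrite geo; ring.
by apply/funext => k /=; ring.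
Qed.

Section weak_dist_mixture.
Context (G : groupType) (e : nat -> G) (R : realType).
Context d (X : measurableType d) (mu : probability X R).

Lemma weak_dist_mixture (t t' : {i01 R}) (a b c a' b' c' : mp_action G mu) :
  (forall n k, partition_statistics e n k c = mixture t%:num
    (partition_statistics e n k a) (partition_statistics e n k b)) ->
  (forall n k, partition_statistics e n k c' = mixture t'%:num
    (partition_statistics e n k a') (partition_statistics e n k b')) ->
  weak_dist e c c' <=
  weak_dist e a a' + weak_dist e b b' + 2 * `|t%:num - t'%:num|.
Proof.
move=> cE c'E.
have t01 (s : {i01 R}) : 0 <= s%:num <= 1 by apply/andP.
have bnd n k (f : mp_action G mu) := @closed_statistics_bounded G e R d X mu n k f.
pose del : R := `|t%:num - t'%:num|.
have del1 : del <= 1.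
  by have /andP[? ?] := t01 t; have /andP[? ?] := t01 t'; rewrite /del ler_norml; lra.
have del0 : 0 <= del by exact: normr_ge0.
pose h n k : R := del / 2 * (2^-1 ^+ n * 2^-1 ^+ k).
have p0 n k : 0 <= 2^-1 ^+ n * 2^-1 ^+ k :> R by rewrite mulr_ge0// exprn_ge0// invr_ge0.
pose g n k := weak_dist_term e b b' n k + h n k.
have dom (f f' : mp_action G mu) n k :
    0 <= weak_dist_term e f f' n k <= 2 * (2^-1 ^+ n * 2^-1 ^+ k).
  by have := @weak_dist_term_bound G e R d X mu f f' n k; have := p0 n k; lra.
have domh n k : 0 <= h n k <= 2 * (2^-1 ^+ n * 2^-1 ^+ k).
  by rewrite /h; have := p0 n k; move: (_ * _) => q q0; apply/andP; split; nra.
have domg n k : 0 <= g n k <= 2 * (2^-1 ^+ n * 2^-1 ^+ k).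
  have := @weak_dist_term_bound G e R d X mu b b' n k; rewrite /g /h; have := p0 n k.
  by move: (weak_dist_term _ _ _ _ _) => w; move: (2^-1 ^+ n * 2^-1 ^+ k) => q q0 wq; nra.
have main : weak_dist e c c' <= weak_dist e a a' + double_series g.
  apply: (@double_series_leD _ 2) => // n k.
  rewrite /g /h /weak_dist_term addSn addnS !exprS exprD.
  have := mixture_hausdorff_dist (t01 t) (t01 t')
    (bnd n.+1 k a) (bnd n.+1 k b) (bnd n.+1 k a') (bnd n.+1 k b').
  rewrite -cE -c'E; have := p0 n k; rewrite -/del.
  move: (2^-1 ^+ n * 2^-1 ^+ k) => q q0; rewrite /closed_statistics.
  move: (hausdorff_dist _ _) => x; move: (hausdorff_dist _ _) => y.
  move: (hausdorff_dist _ _) => z; nra.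
apply: le_trans main _; rewrite -addrA lerD2l.
have -> : 2 * `|t%:num - t'%:num| = double_series h.
  by rewrite double_series_geometric /del; field.
exact: (@double_series_leD _ 2).
Qed.

End weak_dist_mixture.
(** * The convex structure on weak equivalence classes *)

Section mixture_algebra.
Context (R : realType) (V : lmodType R).
Implicit Types (P Q S : set V) (s t r : R).

Lemma mixture0 P Q : P !=set0 -> mixture 0 P Q = Q.
Proof.
move=> [u Pu]; apply/seteqP; split => [_ [w _ [v Qv <-]]|v Qv].
  by rewrite scale0r add0r subr0 scale1r.
by exists u => //; exists v => //; rewrite scale0r add0r subr0 scale1r.
Qed.

Lemma mixtureC t P Q : mixture t P Q = mixture (1 - t) Q P.
Proof.
by apply/seteqP; split => _ [u Pu [v Qv <-]]; exists v => //; exists u => //;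
  rewrite addrC (_ : 1 - (1 - t) = t)//; ring.
Qed.

(** The equation on the parameters also covers s * t = 1: there it reads
    t * (1 - s) = 0, which is true for arbitrary r as s = t = 1 in the unit
    interval. *)
Lemma mixtureA s t r P Q S : t * (1 - s) = (1 - s * t) * r ->
  mixture t (mixture s P Q) S = mixture (s * t) P (mixture r Q S).
Proof.
move=> rE.
have E u v w : t *: (s *: u + (1 - s) *: v) + (1 - t) *: w =
    (s * t) *: u + (1 - s * t) *: (r *: v + (1 - r) *: w).
  rewrite !scalerDr !scalerA -addrA; congr (_ *: _ + (_ *: _ + _ *: _)).
  - by ring.
  - by rewrite rE; ring.
  - have -> : (1 - s * t) * (1 - r) = 1 - s * t - (1 - s * t) * r by ring.
    by rewrite -rE; ring.
apply/seteqP; split.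
  move=> _ [_ [u Pu [v Qv <-]] [w Sw <-]]; rewrite E.
  by exists u => //; exists (r *: v + (1 - r) *: w) => //; exists v => //; exists w.
move=> _ [u Pu [_ [v Qv [w Sw <-]] <-]]; rewrite -E.
by exists (s *: u + (1 - s) *: v); [exists u => //; exists v|exists w].
Qed.

End mixture_algebra.

Section class_conv_theory.
Context (G : groupType) (e : {surj [set: nat] >-> [set: G]}) (R : realType).
Context d (X : measurableType d) (mu : probability X R).
Implicit Types (a b c : mp_action G mu) (p q : weak_classes mu e) (t : {i01 R}).

(** A probability space has no partition into 0 pieces, so statistics are
    compared from 1 piece on: there every action has some, as mixture0
    requires. *)
Lemma weak_class_eq_statistics a b :
  (forall n k, partition_statistics e n k.+1 a = partition_statistics e n k.+1 b) ->
  weak_class e a = weak_class e b.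
Proof.
move=> ab; apply: mdist_positivity; rewrite mdist_weak_class -(weak_distxx e a).
congr double_series; apply/funext => n; apply/funext => k.
rewrite /weak_dist_term /closed_statistics.
by have := ab n.+1 k; rewrite /partition_statistics => ->.
Qed.

Lemma isomorphic_two_copies_statistics t a b c n k :
  isomorphic_actions c (two_copies t a b) ->
  partition_statistics e n k c =
  mixture t%:num (partition_statistics e n k a) (partition_statistics e n k b).
Proof.
by move=> /isomorphic_partition_statistics ->; exact: two_copies_partition_statistics.
Qed.

Lemma mdist_isomorphic_two_copies t t' a b c a' b' c' :
  isomorphic_actions c (two_copies t a b) ->
  isomorphic_actions c' (two_copies t' a' b') ->
  mdist (weak_class e c) (weak_class e c') <=
  mdist (weak_class e a) (weak_class e a') +
  mdist (weak_class e b) (weak_class e b') + 2 * `|t%:num - t'%:num|.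
Proof.
move=> cE c'E; rewrite !mdist_weak_class.
by apply: weak_dist_mixture => n k; exact: isomorphic_two_copies_statistics.
Qed.

(** The class chosen in class_conv comes from some other representatives, for
    which the distance estimate has right-hand side 0. *)
Lemma class_convE t a b c : isomorphic_actions c (two_copies t a b) ->
  class_conv t (weak_class e a) (weak_class e b) = weak_class e c.
Proof.
move=> cE; rewrite /class_conv; case: xgetP => [r _|/(_ (weak_class e c))]; last first.
  by case; exists a, b, c.
move=> [a' [b' [c' [aa' bb' -> c'E]]]]; apply: mdist_positivity.
apply/eqP; rewrite eq_le mdist_ge0 andbT.
apply: le_trans (mdist_isomorphic_two_copies c'E cE) _.
by rewrite -aa' -bb' !mdistxx subrr normr0 mulr0 !addr0.
Qed.

Hypotheses (X_standard : standard_borel R X) (mu_nonatomic : nonatomic mu).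

Lemma weak_class_surj p : exists a, p = weak_class e a.
Proof. by exists (repr p); rewrite /weak_class reprK. Qed.

Lemma class_conv_representative t a b : exists c,
  isomorphic_actions c (two_copies t a b) /\
  class_conv t (weak_class e a) (weak_class e b) = weak_class e c.
Proof.
have [c cE] := two_copies_transport e t a b X_standard mu_nonatomic.
by exists c; split => //; exact: class_convE.
Qed.

Lemma mdist_class_conv t t' p q p' q' :
  mdist (class_conv t p q) (class_conv t' p' q') <=
  mdist p p' + mdist q q' + 2 * `|t%:num - t'%:num|.
Proof.
have [a ->] := weak_class_surj p; have [b ->] := weak_class_surj q.
have [a' ->] := weak_class_surj p'; have [b' ->] := weak_class_surj q'.
have [c [cE ->]] := class_conv_representative t a b.
have [c' [c'E ->]] := class_conv_representative t' a' b'.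
exact: mdist_isomorphic_two_copies.
Qed.

Lemma weak_convex_class_conv : weak_convex (@class_conv G e R d X mu).
Proof.
split.
- move=> p q; have [a ->] := weak_class_surj p; have [b ->] := weak_class_surj q.
  have [c [cE ->]] := class_conv_representative 0%:i01 a b.
  apply: weak_class_eq_statistics => n k.
  rewrite (isomorphic_two_copies_statistics _ _ cE) mixture0//.
  apply/set0P/eqP => a0; have [[M]] := @closed_statistics_bounded _ e _ _ _ mu n k a.
  by rewrite /closed_statistics -/(partition_statistics e n k.+1 a) a0 closure0.
- move=> t p q; have [a ->] := weak_class_surj p; have [b ->] := weak_class_surj q.
  have [c [cE ->]] := class_conv_representative t a b.
  have [c' [c'E ->]] := class_conv_representative (1 - t%:num)%:i01 b a.
  apply: weak_class_eq_statistics => n k.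
  rewrite (isomorphic_two_copies_statistics _ _ cE).
  by rewrite (isomorphic_two_copies_statistics _ _ c'E) mixtureC.
- move=> s t r p q u rE; have [x ->] := weak_class_surj p.
  have [y ->] := weak_class_surj q; have [z ->] := weak_class_surj u.
  have [xy [xyE ->]] := class_conv_representative s x y.
  have [l [lE ->]] := class_conv_representative t xy z.
  have [yz [yzE ->]] := class_conv_representative r y z.
  have [l' [l'E ->]] := class_conv_representative (s%:num * t%:num)%:i01 x yz.
  apply: weak_class_eq_statistics => n k.
  have stE := @isomorphic_two_copies_statistics _ _ _ _ n k.+1.
  rewrite (stE _ _ _ _ lE) (stE _ _ _ _ l'E) (stE _ _ _ _ xyE) (stE _ _ _ _ yzE).
  apply: mixtureA; have [st1|st1] := eqVneq (s%:num * t%:num) 1; last first.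
    by rewrite rE// [RHS]mulrC divfK// subr_eq0 eq_sym.
  have le01 (v : {i01 R}) : 0 <= v%:num <= 1 by apply/andP.
  have /andP[s0 s1] := le01 s; have /andP[t0 t1] := le01 t.
  by rewrite st1 subrr mul0r; nra.
Qed.

Lemma continuous_class_conv :
  continuous (fun z : initial_topology (fun t : {i01 R} => t%:num) *
    (weak_classes mu e * weak_classes mu e) => class_conv z.1 z.2.1 z.2.2).
Proof.
move=> z; apply/cvg_ballP => r r0.
have r4 : 0 < r / 4 by rewrite divr_gt0.
have sum_lt u v w : u < r / 4 -> v < r / 4 -> w < r / 4 -> u + v + 2 * w < r by lra.
pose W : set (initial_topology (fun t : {i01 R} => t%:num)) :=
  [set t | `|(z.1 : {i01 R})%:num - (t : {i01 R})%:num| < r / 4].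
exists (W, ball z.2.1 (r / 4) `*` ball z.2.2 (r / 4)).
  split=> /=; last first.
    by exists (ball z.2.1 (r / 4), ball z.2.2 (r / 4)) => //=; split; exact: nbhsx_ballx.
  have := @initial_continuous _ _ (fun t : {i01 R} => t%:num) z.1.
  move=> /(_ _ (nbhsx_ballx _ _ r4)); rewrite -ball_normE; exact.
move=> z' [/= h1 [h2 h3]]; rewrite ballEmdist /= in h2 h3 *.
apply: le_lt_trans (mdist_class_conv _ _ _ _ _ _) _.
exact: sum_lt.
Qed.

End class_conv_theory.

Theorem proposition4p1 (R : realType) (G : groupType)
  (e : {surj [set: nat] >-> [set: G]})
  (d : measure_display) (X : measurableType d) (mu : probability X R)
  (X_standard : standard_borel R X) (mu_nonatomic : nonatomic mu) :
  topological_weak_convex (@class_conv G e R d X mu).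
Proof.
split; first exact: weak_convex_class_conv.
exact: continuous_class_conv.
Qed.
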